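(* The following problem is decidable: given a regular language $S\subseteq(\Sigma\cup\Gamma)^*$ of finite shiftlag and an unambiguous regular language $T\subseteq(\Sigma\cup\Gamma)^*$ of finite shiftlag, decide whether $\llbracket S\rrbracket\in\textsc{Rel}(T)$.
   Context: $\Sigma,\Gamma$ are disjoint finite alphabets. For $w\in(\Sigma\cup\Gamma)^*$, $\llbracket w\rrbracket=(\pi_{\mathtt i}(w),\pi_{\mathtt o}(w))$ where $\pi_{\mathtt i}$ (resp. $\pi_{\mathtt o}$) deletes all letters of $\Gamma$ (resp. $\Sigma$), and $\llbracket L\rrbracket=\{\llbracket w\rrbracket:w\in L\}$. $\textsc{Rel}(T)=\{\llbracket T'\rrbracket: T'\subseteq T,\ T'\text{ regular}\}$. $T$ is unambiguous if for all $w_1,w_2\in T$, $w_1\neq w_2$ implies $\llbracket w_1\rrbracket\neq\llbracket w_2\rrbracket$. A position $i$ of $w$ is $\geq k$-lagged if the absolute difference between the numbers of $\Sigma$-letters and $\Gamma$-letters in $w[1..i]$ is at least $k$. A shift of $w$ is a position $i\in\{1,\dots,|w|-1\}$ with exactly one of $w[i],w[i+1]$ in $\Sigma$; shifts $i<j$ are consecutive if no shift lies strictly between them. $\mathit{shiftlag}(w)$ is the maximal $n$ such that $w$ contains $n$ consecutive shifts all $\geq n$-lagged; a language has finite shiftlag if the supremum over its words is finite. *)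

(* Defs.v *)
From mathcomp Require Import all_boot.
From Stdlib Require List.

Set Implicit Arguments.
Unset Strict Implicit.
Unset Printing Implicit Defensive.

Inductive code : Type :=
| CZero
| CSucc
| CProj of nat
| CComp of code & seq code
| CPrec of code & code
| CMin of code.

Inductive eval : code -> seq nat -> nat -> Prop :=
| eZero v : eval CZero v 0
| eSucc x v : eval CSucc (x :: v) x.+1
| eProj i v : eval (CProj i) v (nth 0 v i)
| eComp f gs v ys y :
    List.Forall2 (fun g y => eval g v y) gs ys -> eval f ys y ->
    eval (CComp f gs) v y
| ePrec0 f g v y : eval f v y -> eval (CPrec f g) (0 :: v) y
| ePrecS f g n v r y :
    eval (CPrec f g) (n :: v) r -> eval g (n :: r :: v) y ->
    eval (CPrec f g) (n.+1 :: v) y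
| eMin f v n :
    eval f (n :: v) 0 ->
    (forall j, j < n -> exists r, eval f (j :: v) r.+1) ->
    eval (CMin f) v n.

Definition npair (a b : nat) : nat := 2 ^ a * b.*2.+1 - 1.
Fixpoint enc_list (l : seq nat) : nat :=
  if l is x :: l' then (npair x (enc_list l')).+1 else 0.

(** * Alphabets and words.
    Sigma = {0,...,m-1}, Gamma = {m,...,m+k-1}; words are [seq nat]. *)

Definition inSigma (m : nat) (a : nat) : bool := a < m.
Definition alph_word (m k : nat) (w : seq nat) : bool := all (fun a => a < m + k) w.

Definition language := seq nat -> Prop.

(** Deterministic finite automata over letters [0..m+k-1]: states are
    nats, initial state 0, [delta q a = nth 0 (nth [::] dtable q) a]. *)
Record dfa := DFA { dtable : seq (seq nat); finals : seq nat }.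

Definition dfa_run (D : dfa) (w : seq nat) : nat :=
  foldl (fun q a => nth 0 (nth [::] (dtable D) q) a) 0 w.

Definition lang (m k : nat) (D : dfa) : language :=
  fun w => alph_word m k w /\ dfa_run D w \in finals D.

Definition enc_dfa (D : dfa) : nat :=
  npair (enc_list (map enc_list (dtable D))) (enc_list (finals D)).

Definition regular (m k : nat) (L : language) : Prop :=
  exists D : dfa, forall w, L w <-> lang m k D w.

Definition pi_i (m : nat) (w : seq nat) : seq nat := filter (inSigma m) w.
Definition pi_o (m : nat) (w : seq nat) : seq nat := filter (predC (inSigma m)) w.
Definition sem (m : nat) (w : seq nat) : seq nat * seq nat := (pi_i m w, pi_o m w).

Definition relation := seq nat * seq nat -> Prop.

Definition sem_lang (m : nat) (L : language) : relation :=
  fun p => exists w, L w /\ sem m w = p.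

Definition in_Rel (m k : nat) (T : language) (R : relation) : Prop :=
  exists T' : language, regular m k T' /\ (forall w, T' w -> T w) /\
    (forall p, R p <-> sem_lang m T' p).

Definition unambiguous (m : nat) (T : language) : Prop :=
  forall w1 w2, T w1 -> T w2 -> w1 <> w2 -> sem m w1 <> sem m w2.

(** * Shifts and lag (positions are 1-indexed as in the paper). *)

Definition lag (m : nat) (w : seq nat) (i : nat) : nat :=
  let p := take i w in
  let a := count (inSigma m) p in
  let b := count (predC (inSigma m)) p in
  (a - b) + (b - a).

(* w[i] = nth 0 w i.-1, w[i+1] = nth 0 w i *)
Definition is_shift (m : nat) (w : seq nat) (i : nat) : bool :=
  [&& 1 <= i, i < size w & inSigma m (nth 0 w i.-1) != inSigma m (nth 0 w i)].

Definition consecutive_shifts (m : nat) (w : seq nat) (s : seq nat) : Prop :=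
  all (is_shift m w) s /\
  sorted (fun i j => (i < j) && all (fun l => ~~ is_shift m w l) (iota i.+1 (j - i.+1))) s.

Definition shiftlag_ge (m : nat) (w : seq nat) (n : nat) : Prop :=
  exists s, size s = n /\ consecutive_shifts m w s /\ all (fun i => n <= lag m w i) s.

(* sup_{w in L} shiftlag(w) < oo, with shiftlag(w) = max{n | shiftlag_ge w n} *)
Definition finite_shiftlag (m : nat) (L : language) : Prop :=
  exists B, forall w, L w -> forall n, shiftlag_ge m w n -> n <= B.

(* Main.v *)
Require Import Defs.
From mathcomp Require Import all_boot boolp zify.

(** Let S and T be the two languages, with T unambiguous. Then [[S]] is in Rel(T) iff [[S]] is contained in [[T]] and the language R of the words w of T with [[w]] in [[S]] is regular, in which case R is the only possible witness.

Let n exceed the number of states. Finite shiftlag forces a word that has reached lag n to continue with at most 2n blocks, each over a single alphabet: otherwise pumping a loop that increases the lag and a loop that contains a shift gives unbounded shiftlag. Hence membership in [[S]] depends on a pair (x, y) with |x| = |y| at its front only through a finite invariant [tau], and on a factor of the longer component that lies beyond the length of the other one only through a finite invariant [theta].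

If R is regular, its Nerode classes have representatives of bounded length. Prefixes of small lag are separated by finitely many data. Beyond, it suffices to shorten a long block P b of one alphabet, i.e. to find two prefixes of b that have the same [theta] beyond a bounded window and are T-equivalent. If the continuation v makes the other component end inside the window, the invariant [theta] applies at once. If not, a loop y of b in the window is aligned with a loop o of v of equal length and [tau]; synchronous pumping of both loops preserves membership in R, pumping y alone by a multiple of the period of a DFA of R does too, and so y can be pumped until the other component ends before the window does.

So it is enough to search for a DFA D of bounded size with [[S]] = [[L(D) /\ T]]. Such an equality holds as soon as it holds on short pairs, because a longer pair is contracted by [tau] and [theta] simultaneously for both languages. *)

Set Implicit Arguments.
Unset Strict Implicit.
Unset Printing Implicit Defensive.

(** * Words and blocks *)

Section Words.

Variable m : nat.

Implicit Types (b : bool) (u v w x y : seq nat) (n : nat).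

Definition mono b w := all (fun a => inSigma m a == b) w.
Definition track b w := filter (fun a => inSigma m a == b) w.

(** Blocks may be empty and neighbours may share an alphabet, so [blocky n] means at most [n]
    maximal blocks and is monotone in [n]. *)
Fixpoint blocky n v : Prop :=
  if n is n'.+1 then exists b x v', [/\ v = x ++ v', mono b x & blocky n' v']
  else v = [::].

Lemma track_cat b u v : track b (u ++ v) = track b u ++ track b v.
Proof. exact: filter_cat. Qed.

Lemma track_mono b w : mono b w -> track b w = w.
Proof. by move=> h; apply/all_filterP. Qed.

Lemma track_monoN b w : mono (~~ b) w -> track b w = [::].
Proof.
elim: w => //= a w IH /andP[/eqP-> /IH->].
by case: b {IH}.
Qed.

Lemma mono_track b w : mono b (track b w).
Proof. exact: filter_all. Qed.

Lemma mono_cat b u v : mono b (u ++ v) = mono b u && mono b v.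
Proof. exact: all_cat. Qed.

Lemma size_track b w : size w = size (track b w) + size (track (~~ b) w).
Proof.
elim: w => //= a w ->.
by case: (inSigma m a); case: b => /=; rewrite ?addSn ?addnS.
Qed.

Lemma size_track_le b w : size (track b w) <= size w.
Proof. by rewrite (size_track b w) leq_addr. Qed.

Lemma track_split b w x y : track b w = x ++ y ->
  exists u v, [/\ w = u ++ v, track b u = x & track b v = y].
Proof.
elim: w x => [|a w IH] x /=.
  by case: x => //= <-; exists [::], [::].
case: ifP => ha.
  case: x => [|a' x] /=.
    by move=> <-; exists [::], (a :: w); rewrite /= ha.
  case=> <- /IH[u [v [-> <- <-]]].
  by exists (a :: u), v; rewrite /= ha.
move=> /IH[u [v [-> <- <-]]].
by exists (a :: u), v; rewrite /= ha.
Qed.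

Lemma blocky_cons_mono n b x v : mono b x -> blocky n v -> blocky n.+1 (x ++ v).
Proof. by move=> hx hv; exists b, x, v. Qed.

Lemma blocky_nil n : blocky n [::].
Proof. by elim: n => //= n IH; exists true, [::], [::]. Qed.

Lemma blockyS n v : blocky n v -> blocky n.+1 v.
Proof. by move=> h; exists true, [::], v. Qed.

Lemma blocky_le n n' v : n <= n' -> blocky n v -> blocky n' v.
Proof.
move=> /subnK <- h; elim: (n' - n) => [|i IH]; rewrite ?addSn //.
exact: blockyS.
Qed.

Lemma blocky_catl n u v : blocky n (u ++ v) -> blocky n u.
Proof.
elim: n u => [|n IH] u /=; first by case: u.
move=> [b [x [v' [e hx hv']]]].
case: (leqP (size u) (size x)) => h.
  have ->: u = take (size u) x.
    by rewrite -(takel_cat v' h) -e take_size_cat.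
  exists b, (take (size u) x), [::]; rewrite cats0; split=> //.
    by apply/allP => a /mem_take; move/allP: hx; apply.
  exact: blocky_nil.
exists b, x, (drop (size x) u).
have e1 : x = take (size x) u.
  by rewrite -(takel_cat v (ltnW h)) e take_size_cat.
split=> //; first by rewrite -[LHS](cat_take_drop (size x)) -e1.
apply: IH; suff -> : drop (size x) u ++ v = v' by [].
move: e; rewrite -{1}(cat_take_drop (size x) u) -e1 -catA => /eqP.
by rewrite eqseq_cat // eqxx => /eqP.
Qed.

Lemma blocky_catr n u v : blocky n (u ++ v) -> blocky n v.
Proof.
elim: n u => [|n IH] u /=; first by case: u => // _; case: v.
move=> [b [x [v' [e hx hv']]]].
case: (leqP (size x) (size u)) => h.
  exists true, [::], v; split=> //; apply: (IH (drop (size x) u)).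
  suff -> : drop (size x) u ++ v = v' by [].
  rewrite -(drop_size_cat v' (erefl (size x))) -e drop_cat.
  case: ltnP => // h2; have e2 : size x = size u by apply/eqP; rewrite eqn_leq h h2.
  by rewrite e2 drop_size subnn drop0.
exists b, (drop (size u) x), v'; split=> //.
  by rewrite -(drop_size_cat v (erefl (size u))) e drop_cat h.
by apply/allP => a /mem_drop; move/allP: hx; apply.
Qed.

(** Each of the at most [k] letters of alphabet [b] forms a block of its own; the stretches around
    them supply at most [k + 1] further blocks. *)
Lemma blocky_few b v k : size (track b v) <= k -> blocky k.*2.+1 v.
Proof.
elim: k v => [|k IH] v.
  rewrite leqn0 size_eq0 => /eqP h.
  rewrite -[v]cats0; apply: (@blocky_cons_mono _ (~~ b)) => //.
  move: h; elim: v => //= a v IHv; case: ifP => //= h /IHv ->.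
  by move: h; case: (inSigma m a); case: (b).
move=> h.
have [hb|/hasPn hb] := boolP (has (fun a => inSigma m a == b) v).
  case/split_find: hb h => a x y ha hx.
  have -> : track b (rcons x a ++ y) = track b x ++ a :: track b y.
    by rewrite cat_rcons track_cat /= ha.
  rewrite size_cat -cats1 => h.
  rewrite -catA doubleS; apply: (@blocky_cons_mono _ (~~ b)).
    apply/allP => c hc; move/hasPn: hx => /(_ c hc).
    by case: (inSigma m c); case: (b).
  apply: (@blocky_cons_mono _ b [:: a]); first by rewrite /= ha.
  by apply: IH; move: h => /=; lia.
rewrite -[v]cats0; apply: (@blocky_cons_mono _ (~~ b)); last exact: blocky_nil.
apply/allP => c /hb; by case: (inSigma m c); case: (b).
Qed.

Definition nonmono y := ~~ mono true y && ~~ mono false y.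

Lemma nonmonoP b y : nonmono y -> ~~ mono b y.
Proof. by case/andP; case: b. Qed.

Lemma nonmono_cat u v : nonmono u || nonmono v -> nonmono (u ++ v).
Proof.
by rewrite /nonmono !mono_cat; do 4 case: (mono _ _).
Qed.

(** The first block cannot cover [y], so the remaining blocks would have to cover all of [z]. *)
Lemma nblocky_nonmono_cat n y z : nonmono y -> ~ blocky n z -> ~ blocky n.+1 (y ++ z).
Proof.
move=> hy hz [b [x [v' [e hx hv']]]]; apply: hz.
case: (leqP (size y) (size x)) => h.
  case/negP: (nonmonoP b hy).
  have ->: y = take (size y) x by rewrite -(takel_cat v' h) -e take_size_cat.
  by apply/allP => a /mem_take; move/allP: hx; apply.
apply: (@blocky_catr _ (drop (size x) y)).
suff -> : drop (size x) y ++ z = v' by [].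
by rewrite -(drop_size_cat v' (erefl (size x))) -e drop_cat h.
Qed.

(** The prefix [y] ends with the first letter of the other alphabet. It is a block followed by a
    single letter, which accounts for the two blocks lost. *)
Lemma nonmono_prefix n v : ~ blocky n.+2 v ->
  exists y z, [/\ v = y ++ z, nonmono y & ~ blocky n z].
Proof.
case: v => [|a v] h; first by case: h; exact: blocky_nil.
pose b := inSigma m a.
have [hb|/hasPn hb] := boolP (has (fun c => inSigma m c != b) v); last first.
  case: h; rewrite -[a :: v]cats0; apply: (@blocky_cons_mono _ b); last exact: blocky_nil.
  rewrite /= eqxx /=; apply/allP => c /hb; by rewrite negbK.
case/split_find: hb h => c x y hc hx h.
exists (a :: rcons x c), y; split=> //.
  rewrite -cats1 -cat_cons /nonmono !mono_cat /= -/b andbT.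
  by move: hc; case: (inSigma m c); case: (b) => //=; rewrite ?andbF ?andbT.
move=> hy; apply: h; rewrite cat_rcons -cat_cons.
apply: (@blocky_cons_mono _ b).
  rewrite /= eqxx /=; apply/allP => d hd; move/hasPn: hx => /(_ d hd).
  by rewrite negbK.
by rewrite -cat1s; apply: (@blocky_cons_mono _ (inSigma m c)); rewrite //= eqxx.
Qed.

(** The factors [ys] prepare a pigeonhole argument: a loop that spans one of them contains a
    shift. *)
Lemma nblocky_flatten n v : ~ blocky n.*2 v ->
  exists ys z, [/\ size ys = n, v = flatten ys ++ z & all nonmono ys].
Proof.
elim: n v => [|n IH] v h; first by exists [::], v.
have [y [z [-> hy /IH [ys [z' [<- -> hys]]]]]] := nonmono_prefix h.
by exists (y :: ys), z'; rewrite /= hy hys catA.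
Qed.

End Words.

Lemma pigeonhole (X : finType) (f : nat -> X) K : #|X| <= K ->
  exists i j, [/\ i < j, j <= K & f i = f j].
Proof.
move=> hK; pose g (i : 'I_K.+1) := f i.
have /injectivePn [i [j hij e]] : ~~ injectiveb g.
  by apply/injectiveP => /leq_card; rewrite card_ord leqNgt ltnS hK.
have {}hij : (i : nat) != j by [].
case: (ltngtP i j) hij => // h _.
  by exists i, j; rewrite h -ltnS ltn_ord.
by exists j, i; rewrite h -ltnS ltn_ord.
Qed.

Lemma prefix_of_le (T : eqType) (u v u' v' : seq T) : u ++ v = u' ++ v' -> size u <= size u' ->
  exists e, u' = u ++ e /\ v = e ++ v'.
Proof.
move=> e h; exists (drop (size u) u').
have e1 : u = take (size u) u' by rewrite -(takel_cat v' h) -e take_size_cat.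
have e2 : u' = u ++ drop (size u) u' by rewrite -[LHS](cat_take_drop (size u)) -e1.
split=> //; move: e; rewrite {1}e2 -catA => /eqP.
by rewrite eqseq_cat // eqxx => /eqP.
Qed.

(** * Shifts, lag and block decompositions *)

Section Shifts.

Variable m : nat.

Lemma blocky_dup n a c v : inSigma m a = inSigma m c ->
  blocky m n (c :: v) -> blocky m n (a :: c :: v).
Proof.
move=> hac; elim: n => [|n IH] // [b [[|d x] [v' [e hx hv']]]].
  by apply: blockyS; apply: IH; rewrite e.
case: e hx => <- -> hx.
exists b, [:: a, c & x], v'; split=> //.
by move: hx; rewrite /mono /= hac => /andP [-> ->].
Qed.

(** Only shifts whose two letters both lie in [v] are listed; the junction with [u] is left out. *)
Definition shifts_after u v :=
  filter (is_shift m (u ++ v)) (iota (size u).+1 (size v).-1).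

(** Induction on [v]: a new first letter opens a new block only if it is followed by a shift. *)
Lemma blocky_shifts_after u v : blocky m (size (shifts_after u v)).+1 v.
Proof.
elim: v u => [|a [|c v] IH] u; first exact: blocky_nil.
  by exists (inSigma m a), [:: a], [::]; rewrite /= eqxx; split=> //; apply: blocky_nil.
have := IH (rcons u a); rewrite /shifts_after size_rcons cat_rcons.
have nth_l : nth 0 (u ++ [:: a, c & v]) (size u) = a by rewrite nth_cat ltnn subnn.
have nth_r : nth 0 (u ++ [:: a, c & v]) (size u).+1 = c.
  by rewrite nth_cat ltnNge leqnSn subSnn.
rewrite [iota (size u).+1 _]/=; set s := filter _ _ => hs.
rewrite -/s [filter _ (_ :: _)]/= {1}/is_shift [(size u).+1.-1]/= nth_l nth_r -/s.
have -> : (size u).+1 < size (u ++ [:: a, c & v]) by rewrite size_cat /=; lia.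
case: eqP => h; first exact: blocky_dup.
by apply: (@blocky_cons_mono m _ (inSigma m a) [:: a]); rewrite //= eqxx.
Qed.

Lemma sorted_filter_gap (p : pred nat) a n :
  sorted (fun i j => (i < j) && all (fun l => ~~ p l) (iota i.+1 (j - i.+1)))
    (filter p (iota a n)).
Proof.
set R := fun i j => _.
have hp : forall n a i, i < a -> (forall l, i < l < a -> ~~ p l) ->
    path R i (filter p (iota a n)).
  elim=> //= {}n IH {}a i hia hl; case: ifP => ha /=.
    apply/andP; split; last by apply: IH => // l; lia.
    rewrite /R hia; apply/allP => l; rewrite mem_iota => h; apply: hl; lia.
  apply: IH => [|l h]; first lia.
  case: (eqVneq l a) => [->|h2]; first by rewrite ha.
  by apply: hl; lia.
elim: n a => //= n IH a; case: ifP => // ha /=.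
by apply: hp => // l; lia.
Qed.

Lemma lagE b w i : size (track m (~~ b) (take i w)) <= size (track m b (take i w)) ->
  lag m w i = size (track m b (take i w)) - size (track m (~~ b) (take i w)).
Proof.
have ht v : count (inSigma m) v = size (track m true v).
  by rewrite size_filter; apply: eq_count => a; case: inSigma.
have hf v : count (predC (inSigma m)) v = size (track m false v).
  by rewrite size_filter; apply: eq_count => a /=; case: inSigma.
by rewrite /lag ht hf; case: b => /=; lia.
Qed.

(** The lag after [u] is at least [M] plus the length of [v], so it stays at least [M] throughout
    [v]; and a word that does not split into [M] blocks has at least [M] shifts. *)
Lemma shiftlag_ge_of_nblocky b M u v :
  size (track m (~~ b) u) + M + size v <= size (track m b u) -> ~ blocky m M v ->
  shiftlag_ge m (u ++ v) M.
Proof.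
move=> hu hv; pose s := shifts_after u v.
have hs : M <= size s.
  rewrite leqNgt; apply/negP => h; apply: hv.
  exact: blocky_le (blocky_shifts_after u v).
exists (take M s); split; first by rewrite size_takel.
split; first split.
- apply/allP => i /mem_take; by rewrite mem_filter => /andP [].
- by apply: take_sorted; apply: sorted_filter_gap.
apply/allP => i /mem_take; rewrite mem_filter mem_iota => /andP [_ hi].
have e : take i (u ++ v) = u ++ take (i - size u) v.
  by rewrite take_cat ltnNge; case: leqP => //; lia.
have h2 := size_track_le m (~~ b) (take (i - size u) v).
have h3 : size (take (i - size u) v) <= size v by rewrite size_take_min; lia.
rewrite (@lagE b) e !track_cat !size_cat; lia.
Qed.

End Shifts.

(** * Pumping of lag and of shifts in a finite automaton *)

Section Pumping.

Variables (m : nat) (Q : finType) (step : Q -> nat -> Q).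

Definition run q w := foldl step q w.

Lemma run_cat q u v : run q (u ++ v) = run (run q u) v.
Proof. exact: foldl_cat. Qed.

Lemma run_loop q x n : run q x = q -> run q (flatten (nseq n x)) = q.
Proof. by move=> h; elim: n => //= n IH; rewrite run_cat h. Qed.

Lemma exists_loop q u : #|Q| <= size u ->
  exists x y z, [/\ u = x ++ y ++ z, 0 < size y & run q (x ++ y) = run q x].
Proof.
move=> h; have [i [j [hij hj e]]] := pigeonhole (fun i => run q (take i u)) h.
exists (take i u), (drop i (take j u)), (drop j u); split.
- by rewrite catA -{1}(@take_takel _ i j) ?(ltnW hij) // !cat_take_drop.
- by rewrite size_drop size_takel // subn_gt0.
by rewrite -{1}(@take_takel _ i j) ?(ltnW hij) // cat_take_drop.
Qed.

Lemma size_flatten_nseq (T : Type) (x : seq T) n : size (flatten (nseq n x)) = n * size x.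
Proof. by elim: n => //= n IH; rewrite size_cat IH mulSn. Qed.

Lemma track_flatten_nseq b n x : track m b (flatten (nseq n x)) = flatten (nseq n (track m b x)).
Proof. by elim: n => //= n IH; rewrite track_cat IH. Qed.

(* A loop without positive drift is cut out, which shortens the word and does not lower its final lag;
   otherwise it is pumped. *)
Lemma pump_lag b q u M : size (track m (~~ b) u) + #|Q| <= size (track m b u) ->
  exists u', run q u' = run q u /\ size (track m (~~ b) u') + M <= size (track m b u').
Proof.
have [k] := ubnP (size u); elim: k u => // k IH u hk hu.
have hsz : #|Q| <= size u by have := size_track_le m b u; lia.
have [x [y [z [e hy hxy]]]] := exists_loop q hsz.
case: (leqP (size (track m b y)) (size (track m (~~ b) y))) => h.
  have [||u' [h1 h2]] := IH (x ++ z).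
  - by move: hk; rewrite e !size_cat; lia.
  - by move: hu; rewrite e !track_cat !size_cat; lia.
  by exists u'; split=> //; rewrite h1 e catA run_cat [RHS]run_cat hxy.
exists (x ++ flatten (nseq (M + size x + size z) y) ++ z); split.
  by rewrite run_cat in hxy; rewrite e !run_cat run_loop ?hxy //.
rewrite !track_cat !size_cat !track_flatten_nseq !size_flatten_nseq.
have := size_track_le m (~~ b) x; have := size_track_le m (~~ b) z; nia.
Qed.

(** States are compared only at the ends of the factors given by [nblocky_flatten]. The loop found
    there contains a whole nonmono factor, so each further copy of it costs a block. *)
Lemma pump_nblocky q v M : ~ blocky m #|Q|.*2 v ->
  exists v', run q v' = run q v /\ ~ blocky m M v'.
Proof.
move=> /nblocky_flatten [ys [z [hs -> hys]]].
have [i [j [hij hj e]]] := pigeonhole (fun i => run q (flatten (take i ys))) (leqnn _).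
set x := flatten (take i ys) in e.
pose y := flatten (drop i (take j ys)).
have exy : flatten (take j ys) = x ++ y.
  by rewrite -flatten_cat -{1}(@take_takel _ i j) ?(ltnW hij) // cat_take_drop.
have hxy : run (run q x) y = run q x by rewrite -run_cat -exy -e.
have hy : nonmono m y.
  have h2 : size (drop i (take j ys)) = j - i by rewrite size_drop size_takel // hs.
  have h3 : all (nonmono m) (drop i (take j ys)).
    by apply/allP => t /mem_drop /mem_take; move/allP: hys; apply.
  rewrite /y; case: (drop i (take j ys)) h2 h3 => [/=|t ts _ /andP [ht _]]; first lia.
  by rewrite /= nonmono_cat ?ht.
exists (x ++ flatten (nseq M.+1 y) ++ flatten (drop j ys) ++ z); split.
  rewrite -{2}(cat_take_drop j ys) flatten_cat exy !run_cat run_loop ?hxy //.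
move/blocky_catr; elim: M => [|M IH].
  by move: (nonmonoP true hy); case: (y).
by rewrite [flatten _]/= -catA; apply: nblocky_nonmono_cat.
Qed.

Lemma finite_shiftlag_blocky q0 (F : pred Q) n (L : language) :
  (forall w, L w <-> F (run q0 w)) -> #|Q| <= n -> finite_shiftlag m L ->
  forall b u v, L (u ++ v) -> size (track m (~~ b) u) + n <= size (track m b u) ->
  blocky m n.*2 v.
Proof.
move=> hL hn [B hB] b u v huv hu; apply: contrapT => hv.
(* The continuation is pumped first, because the lag reached before it has to exceed its final
   length. *)
have [|v' [e2 hv']] := @pump_nblocky (run q0 u) v B.+1.
  by move=> h; apply: hv; apply: blocky_le h; rewrite leq_double.
have [|u' [e1 hu']] := @pump_lag b q0 u (B.+1 + size v'); first by lia.
have /hB /(_ B.+1) : L (u' ++ v').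
  by apply/hL; rewrite run_cat e1 e2 -run_cat; apply/hL.
rewrite ltnn => h; apply: notF; apply: h.
by apply: (@shiftlag_ge_of_nblocky _ b) => //; lia.
Qed.

End Pumping.

(** * The invariants theta and tau *)

Section Contraction.

Variables (m : nat) (Q : finType) (step : Q -> nat -> Q) (q0 : Q) (F : pred Q) (n : nat).

Local Notation run := (run step).
Local Notation track := (track m).

(** The one consequence of finite shiftlag on which the rest of the argument relies. *)
Definition blocky_after_lag := forall b u v, F (run q0 (u ++ v)) ->
  size (track (~~ b) u) + n <= size (track b u) -> blocky m n.*2 v.

(* [c] splits into one piece per pair, the piece leading from the first state of the pair to the second;
   the pieces may be empty. *)
Fixpoint cuts (ps : seq (Q * Q)) (c : seq nat) : bool :=
  if ps is p :: ps' then
    has (fun i => (run p.1 (take i c) == p.2) && cuts ps' (drop i c)) (iota 0 (size c).+1)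
  else c == [::].

Lemma cuts_consP p ps c :
  reflect (exists c1 c2, [/\ c = c1 ++ c2, run p.1 c1 = p.2 & cuts ps c2]) (cuts (p :: ps) c).
Proof.
apply: (iffP hasP) => [[i _ /andP [/eqP h1 h2]]|[c1 [c2 [-> h1 h2]]]].
  by exists (take i c), (drop i c); rewrite cat_take_drop.
exists (size c1); first by rewrite mem_iota size_cat; lia.
by rewrite take_size_cat // drop_size_cat // h1 eqxx.
Qed.

(* The pieces of one track are the maximal blocks of [e] on that track; they can be exchanged for any
   other pieces with the same state changes, since the blocks of the other track stay in place. *)
Lemma blocky_cuts J b p e : blocky m J e ->
  exists ps, [/\ size ps = J, cuts ps (track b e) & forall c', mono m b c' -> cuts ps c' ->
    exists e', [/\ run p e' = run p e, track b e' = c' & track (~~ b) e' = track (~~ b) e]].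
Proof.
elim: J p e => [|J IH] p e /=.
  move=> ->; exists [::]; split=> // c' _ /eqP ->; by exists [::].
move=> [d [x [e1 [-> hx /(IH (run p x)) [ps [hs hc hr]]]]]].
case: (eqVneq d b) hx => [->|hd] hx.
  exists ((p, run p x) :: ps); split; first by rewrite /= hs.
    apply/cuts_consP; exists x, (track b e1); split=> //.
    by rewrite track_cat (track_mono hx).
  move=> c' hc' /cuts_consP [c1 [c2 [e2 /= h1 h2]]].
  move: hc'; rewrite e2 mono_cat => /andP [hc1 hc2].
  have [e' [h3 h4 h5]] := hr _ hc2 h2.
  have hNN c : mono m b c -> track (~~ b) c = [::].
    by move=> h; apply: track_monoN; rewrite negbK.
  exists (c1 ++ e'); split; first by rewrite !run_cat h1.
    by rewrite track_cat (track_mono hc1) h4.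
  by rewrite !track_cat h5 (hNN _ hc1) (hNN _ hx).
have {}hd : d = ~~ b by move: hd; case: (d); case: (b).
rewrite {}hd in hx.
exists ((run p x, run p x) :: ps); split; first by rewrite /= hs.
  apply/cuts_consP; exists [::], (track b e1); split=> //.
  by rewrite track_cat (track_monoN hx).
move=> c' hc' /cuts_consP [c1 [c2 [e2 /= h1 h2]]].
move: hc'; rewrite e2 mono_cat => /andP [hc1 hc2].
have [e' [h3 h4 h5]] := hr _ hc2 h2.
exists (x ++ c1 ++ e'); split; first by rewrite !run_cat h1.
  by rewrite !track_cat (track_mono hc1) (track_monoN hx) h4.
rewrite !track_cat h5 (@track_monoN _ (~~ b) c1) //; by rewrite negbK.
Qed.

(** Covers both cases below: at most [2n] blocks once the lag is [n], and at most [2n + 1] when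
    fewer than [n] letters of the other track remain. *)
Local Notation J := n.*2.+1.

Definition theta (c : seq nat) : {set J.-tuple (Q * Q)} := [set ps : J.-tuple (Q * Q) | cuts ps c].

(* A word that reads [x ++ x'] and [y ++ y'] first exhausts [x] or [y]; [tau_half b] records the first case: the
   state at that moment, and how the remainder [y2] of [y] is cut by the blocks that follow. *)
Definition tau_half b x y : {set Q * J.-tuple (Q * Q)} :=
  [set z : Q * J.-tuple (Q * Q) | `[< exists u y1 y2, [/\ y = y1 ++ y2, track b u = x, track (~~ b) u = y1,
                                   run q0 u = z.1 & cuts z.2 y2] >]].

Definition tau b x y := (tau_half b x y, tau_half (~~ b) y x).

(** The flag [b] tells which track is the first component, so that either component may be assumed
    to be the longer one. *)
Definition related b X Y := exists w, [/\ F (run q0 w), track b w = X & track (~~ b) w = Y].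

Lemma relatedC b X Y : related b X Y <-> related (~~ b) Y X.
Proof. by split=> -[w [h1 h2 h3]]; exists w; rewrite ?negbK // in h2 h3 *. Qed.

Hypothesis hbl : blocky_after_lag.

(** In a witness [w], the factor [e] that reads [c] has at most [2n + 1] blocks. By [theta] its
    blocks on track [b] can be replaced by pieces of [c'] with the same state changes, the other
    track being kept. *)
Lemma theta_related b X c c' X' Y : size Y <= size X -> mono m b c' -> theta c = theta c' ->
  related b (X ++ c ++ X') Y -> related b (X ++ c' ++ X') Y.
Proof.
move=> hXY hc' hth [w [hF hX hY]].
have [u [v [ew hu /track_split [e [z [ev he hz]]]]]] := track_split hX.
have hbe : blocky m J e.
  case: (leqP (size (track (~~ b) u) + n) (size (track b u))) => h.
    apply: (@blocky_le _ n.*2) => //; apply: (@blocky_catl _ _ _ z).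
    by rewrite -ev; apply: (hbl _ h); rewrite -ew.
  apply: (@blocky_few _ (~~ b)).
  by move: hXY; rewrite -hY ew ev !track_cat !size_cat -hu; lia.
have [ps [hs hcut hr]] := blocky_cuts b (run q0 u) hbe.
have /eqP hs' := hs; pose t : J.-tuple _ := Tuple hs'.
have : t \in theta c by rewrite inE -he.
rewrite hth inE => /(hr _ hc') [e' [h1 h2 h3]].
exists (u ++ e' ++ z); split; first by rewrite run_cat run_cat h1 -2!run_cat -ev -ew.
  by rewrite !track_cat hu h2 hz.
by rewrite -hY ew ev !track_cat h3.
Qed.

(** Here [x] is exhausted first. [tau_half] provides another prefix that reads [x1] and a part of
    [y1] and reaches the same state; the rest of [y1] is then fitted into the factor [e] between the
    two cuts. *)
Lemma tau_half_related b x y x1 y1 u v u' v' : size x = size y -> mono m (~~ b) y1 ->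
  size u <= size u' -> u ++ v = u' ++ v' -> F (run q0 (u ++ v)) ->
  track b u = x -> track (~~ b) u' = y ->
  tau_half b x y = tau_half b x1 y1 ->
  related b (x1 ++ track b v) (y1 ++ track (~~ b) v').
Proof.
move=> hxy hy1 huu' ew hF hu hu' htau.
have [e [e1 e2]] := prefix_of_le ew huu'.
have hy : y = track (~~ b) u ++ track (~~ b) e by rewrite -hu' e1 track_cat.
have hbe : blocky m J e.
  case: (leqP (size (track (~~ b) u) + n) (size (track b u))) => h.
    apply: (@blocky_le _ n.*2) => //; apply: (@blocky_catl _ _ _ v').
    by rewrite -e2; apply: (hbl _ h).
  (* If the lag after [u] is below [n], then fewer than [n] letters of [y] are left for [e], since
     [x] and [y] are equally long. *)
  apply: (@blocky_few _ (~~ b)).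
  by move: h; rewrite hu hxy hy size_cat; lia.
have [ps [hs hcut hr]] := blocky_cuts (~~ b) (run q0 u) hbe.
have /eqP hs' := hs; pose t : J.-tuple _ := Tuple hs'.
have : (run q0 u, t) \in tau_half b x y.
  by rewrite inE; apply/asboolP; exists u, (track (~~ b) u), (track (~~ b) e).
rewrite htau inE => /asboolP [u1 [z1 [z2 [ez hu1 hz1 hq hcut2]]]].
have hz2 : mono m (~~ b) z2 by move: hy1; rewrite ez mono_cat => /andP [].
have [e' [h1 h2 h3]] := hr _ hz2 hcut2.
rewrite negbK in h3.
exists (u1 ++ e' ++ v'); split; first by rewrite !run_cat hq h1 -2!run_cat -e2.
  by rewrite !track_cat hu1 h3 e2 track_cat.
by rewrite !track_cat hz1 h2 ez catA.
Qed.

Lemma tau_related b x y x1 y1 x' y' : size x = size y -> mono m b x1 -> mono m (~~ b) y1 ->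
  tau b x y = tau b x1 y1 -> related b (x ++ x') (y ++ y') -> related b (x1 ++ x') (y1 ++ y').
Proof.
move=> hxy hx1 hy1 [ht1 ht2] [w [hF hX hY]].
have [u [v [ew hu hv]]] := track_split hX.
have [u' [v' [ew' hu' hv']]] := track_split hY.
have e : u ++ v = u' ++ v' by rewrite -ew.
case: (leqP (size u) (size u')) => h.
  rewrite -hv -hv'; apply: (tau_half_related hxy hy1 h e _ hu hu' ht1).
  by rewrite -ew.
have := @tau_half_related (~~ b) y x y1 x1 u' v' u v.
rewrite negbK -hv -hv' => ht; apply/relatedC; apply: ht => //; first exact: ltnW.
by rewrite -ew'.
Qed.

End Contraction.

(** * Enumeration of the words of bounded length *)

Fixpoint words al L : seq (seq nat) :=
  if L is L'.+1 then [::] :: [seq a :: w | a <- iota 0 al, w <- words al L'] else [:: [::]].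

Lemma mem_words al L w : (w \in words al L) = (size w <= L) && all (fun a => a < al) w.
Proof.
elim: L w => [|L IH] [|a w] //=.
rewrite inE /=; apply/allpairsP/idP.
  move=> [[c x] /= [hc hx [-> ->]]]; move: hc hx; rewrite IH mem_iota ltnS /= => -> /andP [-> ->].
  by [].
case/and3P => h1 h2 h3; exists (a, w); split=> //=; first by rewrite mem_iota.
by rewrite IH h3 andbT.
Qed.

Fixpoint num_words al L := if L is L'.+1 then (al * num_words al L').+1 else 1.

Lemma size_words al L : size (words al L) = num_words al L.
Proof. by elim: L => //= L IH; rewrite size_allpairs size_iota IH. Qed.

(** * Bounded representatives of the Nerode classes *)

(** Take the first block of alphabet [b] with at least [K] letters: two of its prefixes receive the
    same value. Earlier blocks are shorter, whence the bound [N * K]. The colouring [f] is arbitrary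
    because it will record more than a state. *)
Lemma mono_loop (m : nat) (X : finType) K (f : seq nat -> X) b N v :
  #|X| <= K -> blocky m N v -> N * K < size (track m b v) ->
  exists v1 o v2, [/\ v = v1 ++ o ++ v2, mono m b o, 0 < size o, f (v1 ++ o) = f v1
    & size (track m b v1) + size o <= N * K].
Proof.
move=> hK; elim: N v f => [|N IH] v f; first by move=> ->.
move=> [d [x [v' [-> hx hv']]]]; rewrite track_cat size_cat => h.
case: (eqVneq d b) hx h => [->|hd] hx h.
  rewrite (track_mono hx) in h.
  case: (leqP K (size x)) => hKx; last first.
    have [|v1 [o [v2 [-> h1 h2 h3 h4]]]] := IH v' (fun w => f (x ++ w)) hv'; first nia.
    exists (x ++ v1), o, v2; rewrite -!catA h3; split=> //.
    by rewrite track_cat size_cat (track_mono hx); nia.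
  have [i [j [hij hj e]]] := pigeonhole (fun i => f (take i x)) hK.
  have hj' := leq_trans hj hKx.
  have ei : take i x = take i (take j x) by rewrite take_takel // ltnW.
  exists (take i x), (drop i (take j x)), (drop j x ++ v').
  have hmt : mono m b (take i x) by apply/allP => a /mem_take; move/allP: hx; apply.
  split.
  - by rewrite !catA ei !cat_take_drop.
  - by apply/allP => a /mem_drop /mem_take; move/allP: hx; apply.
  - by rewrite size_drop size_takel // subn_gt0.
  - by rewrite [in LHS]ei cat_take_drop.
  by rewrite (track_mono hmt) size_drop !size_takel //; nia.
have {}hd : d = ~~ b by move: hd; case: (d); case: (b).
rewrite hd in hx; rewrite (track_monoN hx) in h.
have [|v1 [o [v2 [-> h1 h2 h3 h4]]]] := IH v' (fun w => f (x ++ w)) hv'; first by move: h => /=; nia.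
exists (x ++ v1), o, v2; rewrite -!catA h3; split=> //.
by rewrite track_cat size_cat (track_monoN hx) /=; nia.
Qed.

Section Nerode.

Variables (m n : nat).
Variables (QS : finType) (dS : QS -> nat -> QS) (iS : QS) (FS : pred QS).
Variables (QT : finType) (dT : QT -> nat -> QT) (iT : QT) (FT : pred QT).
Variables (QD : finType) (dD : QD -> nat -> QD) (iD : QD) (FD : pred QD).

Local Notation track := (track m).
Local Notation mono := (mono m).
Local Notation tau := (tau m dS iS n).
Local Notation theta := (theta dS n).
Local Notation related := (related m dS iS FS).
Local Notation J := n.*2.+1.

Hypothesis hS : blocky_after_lag m dS iS FS n.
Hypothesis hT : blocky_after_lag m dT iT FT n.

Let R w := FD (run dD iD w).

Hypothesis hR : forall w, R w <->
  FT (run dT iT w) /\ related true (track true w) (track false w).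

Lemma R_related b w : R w <-> FT (run dT iT w) /\ related b (track b w) (track (~~ b) w).
Proof. by case: b => //; rewrite hR; split=> -[h1 /relatedC h2]. Qed.

Definition nerode u u' := forall v, R (u ++ v) <-> R (u' ++ v).

Definition pw (y : seq nat) i := flatten (nseq i y).

Lemma pwD y i j : pw y (i + j) = pw y i ++ pw y j.
Proof. by rewrite /pw nseqD flatten_cat. Qed.

Lemma pw1 y : pw y 1 = y.
Proof. exact: cats0. Qed.

Lemma mono_pw b y i : mono b y -> mono b (pw y i).
Proof. by move=> h; elim: i => //= i IH; rewrite /pw /= mono_cat h. Qed.

(** The value of [tau] is the same before and after the two loops, so they can be inserted or
    removed together, one pair at a time. *)
Lemma related_sync b X Y y o X' Y' i : size X = size Y -> 
  mono b (X ++ y) -> mono (~~ b) (Y ++ o) -> size y = size o ->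
  tau b X Y = tau b (X ++ y) (Y ++ o) ->
  related b (X ++ X') (Y ++ Y') <-> related b (X ++ pw y i ++ X') (Y ++ pw o i ++ Y').
Proof.
move=> hXY hX hY hyo ht; elim: i => [//|i ->].
rewrite -[i.+1]add1n !pwD !pw1 -!catA (catA X y) (catA Y o).
have [hX1 hY1] : mono b X /\ mono (~~ b) Y.
  by move: hX hY; rewrite !mono_cat => /andP [-> _] /andP [-> _].
have hXyY : size (X ++ y) = size (Y ++ o) by rewrite !size_cat hXY hyo.
by split; [apply: (tau_related hS hXY) | apply: (tau_related hS hXyY)].
Qed.

(** The states reached by the powers of [y] form an ultimately periodic sequence, with preperiod
    [i0] and period [d]. *)
Lemma eventual_period q y : exists i0 d, 0 < d /\
  forall c, run dD q (pw y (i0 + c * d)) = run dD q (pw y i0).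
Proof.
have [i [j [hij _ e]]] := pigeonhole (fun i => run dD q (pw y i)) (leqnn _).
exists i, (j - i); split; first by rewrite subn_gt0.
elim=> [|c IH]; first by rewrite addn0.
by rewrite mulSn addnCA addnC pwD run_cat IH -run_cat -pwD subnKC // ltnW.
Qed.

(* Pump both loops [i0] times, then [y] alone by a period of the automaton of [R], then unpump both. *)
Lemma R_pump b A0 y A1 o A2 i0 j :
  mono b y -> mono (~~ b) o -> size y = size o ->
  size (track b A0) = size (track (~~ b) (A0 ++ A1)) ->
  tau b (track b A0) (track (~~ b) (A0 ++ A1)) =
    tau b (track b A0 ++ y) (track (~~ b) (A0 ++ A1) ++ o) ->
  run dT iT (A0 ++ y) = run dT iT A0 ->
  run dT iT (A0 ++ A1 ++ o) = run dT iT (A0 ++ A1) ->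
  run dD (run dD iD A0) (pw y (1 + i0)) = run dD (run dD iD A0) (pw y (j + i0)) ->
  R (A0 ++ pw y 1 ++ A1 ++ pw o 1 ++ A2) <-> R (A0 ++ pw y j ++ A1 ++ pw o 1 ++ A2).
Proof.
move=> hy ho hyo hsz ht hTy hTo hD.
have hTF j' k' : run dT iT (A0 ++ pw y j' ++ A1 ++ pw o k' ++ A2) = run dT iT (A0 ++ A1 ++ A2).
  by move: hTy hTo; rewrite !run_cat => hTy' hTo'; rewrite (run_loop j' hTy') (run_loop k' hTo').
have hF j' k' : R (A0 ++ pw y j' ++ A1 ++ pw o k' ++ A2) <-> FT (run dT iT (A0 ++ A1 ++ A2)) /\
  related b (track b A0 ++ pw y j' ++ track b (A1 ++ A2))
    (track (~~ b) (A0 ++ A1) ++ pw o k' ++ track (~~ b) A2).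
  rewrite (R_related b) hTF !track_cat.
  rewrite (track_mono (mono_pw _ hy)) (track_mono (mono_pw _ ho)).
  rewrite (@track_monoN _ b (pw o k')) ?(@track_monoN _ (~~ b) (pw y j')) ?negbK ?mono_pw //=.
  by rewrite !catA.
have hX : mono b (track b A0 ++ y) by rewrite mono_cat mono_track.
have hY : mono (~~ b) (track (~~ b) (A0 ++ A1) ++ o) by rewrite mono_cat mono_track.
have hsync j' k' : R (A0 ++ pw y j' ++ A1 ++ pw o k' ++ A2) <->
    R (A0 ++ pw y (j' + i0) ++ A1 ++ pw o (k' + i0) ++ A2).
  rewrite !hF ![_ + i0]addnC !pwD -!catA.
  by rewrite (related_sync _ _ i0 hsz hX hY hyo ht).
rewrite hsync (hsync j) /R.
by rewrite run_cat [X in FD X]run_cat hD -!run_cat.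
Qed.

Definition loop_count := #|{: (({set QS * J.-tuple (QS * QS)} * {set QS * J.-tuple (QS * QS)}) * QT * QT)%type}|.
(** Room for [l] letters of the prefix, [n] letters of lag, and the [2n * (loop_count + 1)] letters
    among which [mono_loop] finds its loop. *)
Definition window_len l := l + n + n.*2 * loop_count.+1.
(** Past the window, enough positions that two of them agree on the state of [dT] and on [theta] of
    the factors from every window position up to them. *)
Definition block_len l := window_len l + #|{: (QT * {ffun 'I_(window_len l).+1 -> {set J.-tuple (QS * QS)}})%type}|.

(** * Shortening a long block over one alphabet *)

Section MonochromeBlock.

Variables (l : nat) (P : seq nat) (b : bool) (blk : seq nat).
Hypotheses (hPl : size P <= l) (hblk : mono b blk).

Lemma mono_take i : mono b (take i blk).
Proof. by apply/allP => a /mem_take; move/allP: hblk; apply. Qed.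

Lemma mono_drop_take i j : mono b (drop i (take j blk)).
Proof. by apply/allP => a /mem_drop /mem_take; move/allP: hblk; apply. Qed.

Lemma track_b_P : size (track b P) <= l.
Proof. exact: leq_trans (size_track_le _ _ _) hPl. Qed.

Section Transfer.

Variables (s t : nat) (v : seq nat).
Hypotheses (hAs : window_len l <= s) (hAt : window_len l <= t) (hsz : s <= size blk) (htz : t <= size blk).
Hypothesis hst : run dT iT (P ++ take s blk) = run dT iT (P ++ take t blk).
Hypothesis hth : forall a, a <= window_len l -> theta (drop a (take s blk)) = theta (drop a (take t blk)).

Lemma take_split a r : a <= r -> take r blk = take a blk ++ drop a (take r blk).
Proof. by move=> h; rewrite -{1}(cat_take_drop a (take r blk)) take_takel. Qed.

(** The two cuts of [blk] share their first [window_len l] letters and the other component ends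
    within that length, so [theta_related] applies directly. *)
Lemma transfer_short : size (track (~~ b) (P ++ v)) <= window_len l ->
  R (P ++ take s blk ++ v) -> R (P ++ take t blk ++ v).
Proof.
move=> hO /(R_related b) [h1 h2]; apply/(R_related b); split.
  by move: h1; rewrite !catA !(run_cat _ _ _ v) hst.
move: h2; rewrite !track_cat !(track_mono (mono_take _)).
rewrite !(@track_monoN _ (~~ b) (take _ _)) ?negbK ?mono_take //=.
rewrite (take_split hAs) (take_split hAt) -!catA !(catA (track b P)).
apply: (theta_related hS _ (mono_drop_take _ _) (hth (leqnn _))).
rewrite -track_cat; apply: leq_trans hO _.
rewrite size_cat size_takel ?leq_addl //; exact: leq_trans hsz.
Qed.

(* The window of [blk] is aligned with letters of [v] on the other track; two positions there agree on
   [tau] and on the states of [T], which yields the loops [y] and [o] for [R_pump]. *)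
Lemma transfer_long : window_len l < size (track (~~ b) (P ++ v)) ->
  R (P ++ take s blk ++ v) -> R (P ++ take t blk ++ v).
Proof.
move=> hO hRs.
pose O := track (~~ b) v.
(* With [k] more letters the other component has length exactly [l], at least that of [track b P];
   from there on its letters are matched with letters of [blk]. *)
pose k := l - size (track (~~ b) P).
have hOP : size (track (~~ b) P) <= l by exact: leq_trans (size_track_le _ _ _) hPl.
have hOk : k <= size O.
  by move: hO; rewrite track_cat size_cat -/O /k /window_len; lia.
have [va [vb [ev hva hvb]]] := track_split (esym (cat_take_drop k O)).
(* At this point the track of [blk] is ahead by at least [n] letters. *)
have hbvb : blocky m n.*2 vb.
  have /(R_related b) [hFT _] := hRs.
  apply: (@hT b (P ++ take s blk ++ va) vb); first by rewrite -!catA -ev.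
  rewrite !track_cat (track_mono (mono_take _)) !size_cat size_takel //.
  rewrite (@track_monoN _ (~~ b) (take _ _)) ?negbK ?mono_take //= hva size_takel //.
  by move: hAs; rewrite /k /window_len; lia.
(* [pos v1] is the length of the other component after [P ++ va ++ v1]. The colour [f] records [tau]
   at this common length, the state of [dT] in the continuation, and its state at the aligned place
   of [blk]. *)
pose pos v1 := l + size (track (~~ b) v1).
pose f v1 := (tau b (take (pos v1) (track b P ++ blk)) (track (~~ b) (P ++ va ++ v1)),
  run dT iT (P ++ take s blk ++ va ++ v1), run dT iT (P ++ take (pos v1 - size (track b P)) blk)).
have [|v1 [o [v2 [evb ho ho0 [hf1 hf2 hf3 hf4] hsz1]]]] :=
    mono_loop (b := ~~ b) f (leqnSn loop_count) hbvb.
  by rewrite hvb size_drop; move: hO; rewrite track_cat size_cat -/O /k /window_len; lia.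
pose p := pos v1; pose i := p - size (track b P).
have hi' : i + size o <= window_len l.
  apply: (@leq_trans (l + (size (track (~~ b) v1) + size o))); first by rewrite /i /p /pos; lia.
  by rewrite /window_len -addnA leq_add2l (leq_trans hsz1) // leq_addl.
have hpi : p = size (track b P) + i by have := track_b_P; rewrite /i /p /pos; lia.
have hpos : pos (v1 ++ o) = p + size o.
  by rewrite /p /pos track_cat (track_mono ho) size_cat addnA.
have hposi : p + size o - size (track b P) = i + size o by rewrite hpi; lia.
have hblki : i + size o <= size blk by lia.
pose y := drop i (take (i + size o) blk).
have hyo : size y = size o by rewrite /y size_drop size_takel // addKn.
have hy : mono b y by exact: mono_drop_take.
have [A0 eA0] : exists A0, A0 = P ++ take i blk by eexists.
have eA0y : A0 ++ y = P ++ take (i + size o) blk.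
  by rewrite eA0 -catA -take_split // leq_addr.
have hA0 : track b A0 = take p (track b P ++ blk).
  rewrite eA0 track_cat (track_mono (mono_take _)) hpi take_cat ltnNge leq_addr /=.
  by rewrite addKn.
have hA0y : track b A0 ++ y = take (p + size o) (track b P ++ blk).
  rewrite -{1}(track_mono hy) -track_cat eA0y track_cat (track_mono (mono_take _)).
  by rewrite hpi -addnA take_cat ltnNge leq_addr /= addKn.
have hva' : size (track (~~ b) (P ++ va)) = l.
  by rewrite track_cat size_cat hva size_takel // /k; lia.
pose A1 r := drop (i + size o) (take r blk) ++ va ++ v1.
have hNb c : mono b c -> track (~~ b) c = [::] by move=> h; apply: track_monoN; rewrite negbK.
have hNt r : track (~~ b) (take r blk) = [::] by apply: hNb; apply: mono_take.
have hNd r r' : track (~~ b) (drop r (take r' blk)) = [::] by apply: hNb; apply: mono_drop_take.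
have hA01 r : track (~~ b) (A0 ++ A1 r) = track (~~ b) (P ++ va ++ v1).
  by rewrite eA0 /A1 !track_cat hNt hNd cats0.
have hw r c : i + size o <= r -> P ++ take r blk ++ c = A0 ++ y ++ drop (i + size o) (take r blk) ++ c.
  by move=> hr; rewrite [RHS]catA eA0y {1}(take_split hr) -!catA.
have hTy : run dT iT (A0 ++ y) = run dT iT A0.
  by rewrite eA0y; move: hf4; rewrite hpos hposi eA0.
have hTo r : window_len l <= r -> run dT iT (P ++ take r blk) = run dT iT (P ++ take s blk) ->
    run dT iT (A0 ++ A1 r ++ o) = run dT iT (A0 ++ A1 r).
  move=> hr e.
  have h c : run dT iT (A0 ++ drop (i + size o) (take r blk) ++ c) = run dT iT (P ++ take s blk ++ c).
    rewrite run_cat -hTy -run_cat -catA.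
    by rewrite -hw ?(leq_trans hi') // catA run_cat e -run_cat -catA.
  by rewrite /A1 -!catA !h hf3.
have hsz0 : size (track b A0) = p.
  by rewrite hA0 size_takel // size_cat hpi leq_add2l; lia.
have [i0 [d [hd hper]]] := eventual_period (run dD (run dD iD A0) y) y.
(* As [d] and the length of [y] are positive, [j] copies of [y] are longer than the whole other
   component. *)
have [j ej] : exists j, j = 1 + size (track (~~ b) (P ++ v)) * d by eexists.
have hpump r : window_len l <= r -> run dT iT (P ++ take r blk) = run dT iT (P ++ take s blk) ->
    R (P ++ take r blk ++ v) <-> R (A0 ++ pw y j ++ A1 r ++ pw o 1 ++ v2).
  move=> hr e; rewrite hw ?(leq_trans hi') //.
  rewrite -(@R_pump b A0 y (A1 r) o v2 i0 j) //.
  - by rewrite !pw1 ev evb /A1 -!catA.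
  - by rewrite hA01 hsz0 catA track_cat size_cat hva'.
  - rewrite hA01 hA0y hA0 -hpos -/f.
    have -> : track (~~ b) (P ++ va ++ v1) ++ o = track (~~ b) (P ++ va ++ v1 ++ o).
      by rewrite !track_cat (track_mono ho) -!catA.
    by move: hf1 hf2; rewrite /tau => -> ->.
  - exact: hTo.
  - by rewrite add1n ej -addnA add1n /pw /= !(run_cat _ _ y) addnC hper.
have /(hpump s hAs erefl) hRj := hRs; apply/(hpump t hAt (esym hst)).
move: hRj => /(R_related b) [h1 h2]; apply/(R_related b).
have hFT r : window_len l <= r -> run dT iT (P ++ take r blk) = run dT iT (P ++ take s blk) ->
    run dT iT (A0 ++ pw y j ++ A1 r ++ pw o 1 ++ v2) = run dT iT (P ++ take s blk ++ v).
  move=> hr e; rewrite pw1 run_cat [run dT (run dT iT A0) _]run_cat run_loop; last by rewrite -run_cat.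
  rewrite -hTy -run_cat -catA /A1 -!catA -hw ?(leq_trans hi') //.
  by rewrite catA run_cat e -run_cat ev evb -!catA.
split; first by rewrite hFT // -(hFT s).
move: h2; rewrite /A1 !track_cat !hNd (hNb (pw y j)) ?mono_pw //=.
rewrite !(track_mono (mono_drop_take _ _)) (track_mono (mono_pw _ hy)).
rewrite -!catA !(catA (track b A0) (pw y j)).
(* After pumping, the other component ends before the factor that starts at [i + size o] in [blk].
   This is why [hth] is required at every window position. *)
apply: (theta_related hS _ (mono_drop_take _ _) (hth hi')).
have -> : track (~~ b) A0 = track (~~ b) P by rewrite eA0 track_cat hNt cats0.
rewrite /= -!track_cat -evb -ev size_cat size_flatten_nseq hyo.
move: (size (track (~~ b) (P ++ v))) ej => N ->.
apply: leq_trans (leq_addl _ _); apply: leq_trans (leq_pmulr _ ho0).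
by rewrite add1n ltnW // ltnS leq_pmulr.
Qed.

Lemma transfer : R (P ++ take s blk ++ v) -> R (P ++ take t blk ++ v).
Proof.
by case: (leqP (size (track (~~ b) (P ++ v))) (window_len l)) => [/transfer_short|/transfer_long]; apply.
Qed.

End Transfer.

Lemma nerode_block : block_len l <= size blk -> exists s t,
  [/\ s < t, t <= block_len l & nerode (P ++ take s blk) (P ++ take t blk)].
Proof.
move=> hG.
pose f i := (run dT iT (P ++ take (window_len l + i) blk),
  [ffun a : 'I_(window_len l).+1 => theta (drop a (take (window_len l + i) blk))]).
have [i [j [hij hj [e1 /ffunP e2]]]] := pigeonhole f (leqnn _).
exists (window_len l + i), (window_len l + j); split; rewrite ?leq_add2l ?ltn_add2l //.
have hj' : window_len l + j <= size blk by apply: leq_trans hG; rewrite leq_add2l.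
have hi' : window_len l + i <= size blk by apply: leq_trans hj'; rewrite leq_add2l ltnW.
have e3 a : a <= window_len l ->
    theta (drop a (take (window_len l + i) blk)) = theta (drop a (take (window_len l + j) blk)).
  by move=> ha; have := e2 (Ordinal (ha : a < (window_len l).+1)); rewrite !ffunE.
move=> v; rewrite -!catA; split; apply: transfer => //; rewrite ?leq_addr // => a /e3 //.
Qed.

End MonochromeBlock.

(** * Equivalent prefixes of a long word *)

Variable al : nat.

Local Notation inal := (all (fun a => a < al)).

Definition lead v := size (track false v) <= size (track true v).
Definition common b v := take (size (track (~~ b) v)) (track b v).
Definition excess b v := drop (size (track (~~ b) v)) (track b v).

(** [tau] is applied to the equally long parts of the two tracks; at small lag the excess has fewer
    than [n] letters and is stored by its index. The ordinal has one value more than the list has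
    entries, as [index] may return the size of the list. *)
Definition lag_state v : QT * bool * 'I_(num_words al n).+1 *
    ({set QS * J.-tuple (QS * QS)} * {set QS * J.-tuple (QS * QS)}) :=
  (run dT iT v, lead v, inord (index (excess (lead v) v) (words al n)),
   tau (lead v) (common (lead v) v) (track (~~ lead v) v)).

Definition small_lag v := [forall b : bool, size (track b v) < size (track (~~ b) v) + n].

Lemma leadP v : size (track (~~ lead v) v) <= size (track (lead v) v).
Proof. by rewrite /lead; have [//|/ltnW] := leqP (size (track false v)) (size (track true v)). Qed.

Lemma excess_words v : inal v -> small_lag v -> excess (lead v) v \in words al n.
Proof.
move=> hv /forallP /(_ (lead v)) h; rewrite mem_words; apply/andP; split.
  by rewrite size_drop; move: h; set N1 := size _; set N2 := size _; lia.
by apply/allP => a /mem_drop; rewrite mem_filter => /andP [_]; move/allP: hv; apply.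
Qed.

(** The excess is the same for both words, so it is counted with the continuation and [tau_related]
    exchanges what precedes it. *)
Lemma lag_state_transfer v v' z : inal v -> inal v' -> small_lag v -> small_lag v' ->
  lag_state v = lag_state v' -> R (v ++ z) -> R (v' ++ z).
Proof.
move=> hv hv' hsv hsv' [e1 e2 e3 e4 e5].
have ex : excess (lead v) v = excess (lead v') v'.
  have hw := excess_words hv hsv; have hw' := excess_words hv' hsv'.
  have := congr1 val e3; rewrite /= !inordK ?ltnS -?size_words ?index_size //.
  by move=> e; rewrite -(nth_index [::] hw) -(nth_index [::] hw') e.
rewrite -e2 in ex e4 e5; set b := lead v in ex e4 e5.
have hle : size (track (~~ b) v) <= size (track b v) by exact: leadP.
have hle' : size (track (~~ b) v') <= size (track b v') by rewrite /b e2; exact: leadP.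
move=> /(R_related b) [h1 h2]; apply/(R_related b); split; first by rewrite run_cat -e1 -run_cat.
move: h2; rewrite !track_cat.
have hc w : track b w = common b w ++ excess b w by rewrite cat_take_drop.
rewrite !hc -ex -!catA.
apply: (tau_related hS); rewrite ?mono_track //.
- by rewrite /common size_takel.
- by apply/allP => a /mem_take; rewrite mem_filter => /andP [].
- by rewrite /tau e4 e5.
Qed.

Definition lag_state_count := #|{: (QT * bool * 'I_(num_words al n).+1 *
    ({set QS * J.-tuple (QS * QS)} * {set QS * J.-tuple (QS * QS)}))%type}|.

Definition collapses (u : seq nat) N :=
  exists i j, [/\ i < j, j <= N, j <= size u & nerode (take i u) (take j u)].

Lemma small_lag_collapses u : lag_state_count <= size u -> inal u ->
  (forall i, i <= lag_state_count -> small_lag (take i u)) -> collapses u lag_state_count.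
Proof.
move=> hu ha hs.
have [i [j [hij hj e]]] := pigeonhole (fun i => lag_state (take i u)) (leqnn lag_state_count).
exists i, j; split=> //; first exact: leq_trans hu.
have hat r : inal (take r u) by apply/allP => c /mem_take; move/allP: ha; apply.
have hi : i <= lag_state_count by rewrite (leq_trans _ hj) // ltnW.
by move=> z; split; apply: lag_state_transfer => //; apply: hs.
Qed.

(** The length bound for a prefix of length at most [l] followed by [N] blocks, each shorter than
    [block_len] of the bound reached before it. A longer word therefore has a block to which
    [nerode_block] applies. *)
Fixpoint word_len l N := if N is N'.+1 then word_len (l + block_len l) N' else l.

Lemma word_len_ge l N : l <= word_len l N.
Proof.
by elim: N l => //= N IH l; apply: leq_trans (IH _); apply: leq_addr.
Qed.

Lemma blocky_collapses N l P v : blocky m N v -> size P <= l -> word_len l N < size (P ++ v) ->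
  collapses (P ++ v) (size (P ++ v)).
Proof.
elim: N l P v => [|N IH] l P v; first by move=> -> hP; rewrite cats0 ltnNge hP.
move=> [b [x [v' [-> hx hv']]]] hP /= hL.
case: (leqP (block_len l) (size x)) => h; last first.
  rewrite catA; apply: IH hv' _ _; last by rewrite -catA; exact: hL.
  by rewrite size_cat leq_add // ltnW.
have [s [t [hst ht hn]]] := nerode_block hP hx h.
have ht' := leq_trans ht h.
have htake r : r <= size x -> take (size P + r) (P ++ x ++ v') = P ++ take r x.
  by move=> hr; rewrite take_cat ltnNge leq_addr /= addKn takel_cat.
exists (size P + s), (size P + t); rewrite ltn_add2l !size_cat leq_add2l.
by rewrite (leq_trans ht') ?leq_addr // !htake // (leq_trans _ ht') // ltnW.
Qed.

(** Either the lag stays small long enough for two prefixes to share [lag_state], or a short prefix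
    has lag at least [n]; then the rest of [u] has at most [2n] blocks, because [u] extends to a
    word of T. *)
Lemma alive_collapses u z : inal u -> R (u ++ z) -> word_len lag_state_count n.*2 < size u ->
  collapses u (size u).
Proof.
move=> ha hz hL.
have hM : lag_state_count <= size u by rewrite (leq_trans (word_len_ge _ n.*2)) // ltnW.
case: (boolP [forall i : 'I_lag_state_count.+1, small_lag (take i u)]) => [/forallP h|].
  have [i hi|i [j [h1 h2 h3 h4]]] := small_lag_collapses hM ha.
    exact: (h (Ordinal (hi : i < lag_state_count.+1))).
  by exists i, j.
rewrite negb_forall => /existsP [i]; rewrite negb_forall => /existsP [b]; rewrite -leqNgt => hlag.
rewrite -(cat_take_drop i u); apply: (@blocky_collapses n.*2 lag_state_count).
- apply: (@blocky_catl _ _ _ z); apply: (@hT b (take i u)).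
    by rewrite catA cat_take_drop; case/(R_related b): hz.
  by [].
- by rewrite size_take_min geq_min -ltnS ltn_ord.
by rewrite cat_take_drop.
Qed.

(* A dead word is equivalent to each of its extensions, whence the successor in the length bound. *)
Lemma nerode_words u : inal u ->
  exists u', u' \in words al (word_len lag_state_count n.*2).+1 /\ nerode u u'.
Proof.
elim/last_ind: u => [_|u a IH]; first by exists [::]; rewrite mem_words.
rewrite all_rcons => /andP [haa /IH [u' []]].
rewrite mem_words => /andP [hsz hu'] hn.
have hcons : forall x y, nerode x y -> nerode (rcons x a) (rcons y a).
  by move=> x y h z; rewrite -!cats1 -!catA; apply: h.
case: (ltnP (size u') (word_len lag_state_count n.*2).+1) => h.
  exists (rcons u' a); split; last exact: hcons.
  by rewrite mem_words size_rcons h all_rcons haa.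
case: (pselect (exists z, R (u' ++ z))) => [[z hz]|hdead]; last first.
  exists u'; split; first by rewrite mem_words hsz.
  move=> z; rewrite cat_rcons (hn (a :: z)); split=> hz; case: hdead.
    by exists (a :: z).
  by exists z.
(* [u'] is too long to take another letter; cutting out the factor between two equivalent prefixes
   makes room for [a]. *)
have [i [j [hij _ hj hc]]] := alive_collapses hu' hz h.
exists (rcons (take i u' ++ drop j u') a); split.
  rewrite mem_words size_rcons size_cat size_takel ?size_drop; last by rewrite (leq_trans _ hj) // ltnW.
  rewrite all_rcons haa all_cat /=; apply/and3P; split.
    by rewrite (leq_trans _ hsz) //; move: (size u') hj => N hj; lia.
    by apply/allP => c /mem_take; move/allP: hu'; apply.
  by apply/allP => c /mem_drop; move/allP: hu'; apply.
apply: hcons => y; rewrite hn -{1}(cat_take_drop j u') -!catA.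
by split=> /hc.
Qed.

End Nerode.

(** * Inclusion of relations and encoding of automata *)

Section Inclusion.

Variables (m n : nat).
Variables (Q1 : finType) (d1 : Q1 -> nat -> Q1) (i1 : Q1) (F1 : pred Q1).
Variables (Q2 : finType) (d2 : Q2 -> nat -> Q2) (i2 : Q2) (F2 : pred Q2).

Local Notation J := n.*2.+1.

Hypothesis h1 : blocky_after_lag m d1 i1 F1 n.
Hypothesis h2 : blocky_after_lag m d2 i2 F2 n.

Definition tau_count := #|{: (({set Q1 * J.-tuple (Q1 * Q1)} * {set Q1 * J.-tuple (Q1 * Q1)}) *
   ({set Q2 * J.-tuple (Q2 * Q2)} * {set Q2 * J.-tuple (Q2 * Q2)}))%type}|.
Definition theta_count := #|{: ({set J.-tuple (Q1 * Q1)} * {set J.-tuple (Q2 * Q2)})%type}|.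

Local Notation related1 := (related m d1 i1 F1).
Local Notation related2 := (related m d2 i2 F2).

Lemma mono_related b X Y : related1 b X Y -> mono m b X /\ mono m (~~ b) Y.
Proof. by case=> w [_ <- <-]; rewrite !mono_track. Qed.

(** Induction on the total length. If both components are long, two common prefix lengths agree on
    [tau] for both automata; if only one is, two cuts past the end of the other agree on [theta] for
    both. The pair is contracted with the first automaton and expanded again with the second. *)
Lemma related_incl :
  (forall b X Y, size X + size Y <= tau_count.*2 + theta_count -> related1 b X Y -> related2 b X Y) ->
  forall b X Y, related1 b X Y -> related2 b X Y.
Proof.
move=> hbase b X Y; have [N] := ubnP (size X + size Y); elim: N b X Y => // N IH.
suff hw b X Y : size Y <= size X -> size X + size Y < N.+1 -> related1 b X Y -> related2 b X Y.
  move=> b X Y hN hr; case: (leqP (size Y) (size X)) => [h|/ltnW h]; first exact: hw.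
  by apply/relatedC; apply: hw => //; [rewrite addnC | apply/relatedC; rewrite negbK].
move=> hYX hN hr; have [hX hY] := mono_related hr.
have mt c r Z : mono m c Z -> mono m c (take r Z).
  by move=> hZ; apply/allP => a /mem_take; move/allP: hZ; apply.
have md c r Z : mono m c Z -> mono m c (drop r Z).
  by move=> hZ; apply/allP => a /mem_drop; move/allP: hZ; apply.
case: (leqP tau_count (size Y)) => hK.
  have [i [j [hij hj [e1 e2 e3 e4]]]] := pigeonhole
    (fun i => (tau m d1 i1 n b (take i X) (take i Y), tau m d2 i2 n b (take i X) (take i Y)))
    (leqnn tau_count).
  have hjY := leq_trans hj hK; have hjX := leq_trans hjY hYX.
  have hsz r : r <= size Y -> size (take r X) = size (take r Y).
    by move=> hrY; rewrite !size_takel // (leq_trans hrY).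
  rewrite -(cat_take_drop j X) -(cat_take_drop j Y).
  apply: (tau_related h2 (hsz i _)); rewrite ?mt ?(leq_trans (ltnW hij)) //.
    by rewrite /tau e3 e4.
  apply: IH.
    by rewrite !size_cat !size_drop !size_takel; lia.
  apply: (tau_related h1 (hsz j hjY)); rewrite ?mt //.
    by rewrite /tau e1 e2.
  by rewrite !cat_take_drop.
case: (leqP (tau_count + theta_count) (size X)) => hX2; last first.
  by apply: hbase => //; rewrite -addnn; lia.
pose p := size Y.
have [i [j [hij hj [e1 e2]]]] := pigeonhole
    (fun i => (theta d1 n (drop p (take (p + i) X)), theta d2 n (drop p (take (p + i) X))))
    (leqnn theta_count).
have hdec r : X = take p X ++ drop p (take (p + r) X) ++ drop (p + r) X.
  rewrite catA -{1}(@take_takel _ p (p + r)) ?leq_addr //.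
  by rewrite !cat_take_drop.
have hp : size (take p X) = p by rewrite size_takel.
rewrite (hdec j).
apply: (theta_related h2 _ _ e2); rewrite ?hp ?md ?mt //.
apply: IH.
  by rewrite !size_cat !size_drop !size_takel; lia.
apply: (theta_related h1 _ _ (esym e1)); rewrite ?hp ?md ?mt //.
by rewrite -hdec.
Qed.

End Inclusion.

(** * Coding of lists and automata by numbers *)

Lemma npair_gt0 a b : 0 < 2 ^ a * b.*2.+1.
Proof. by rewrite muln_gt0 expn_gt0. Qed.

Lemma npair_ge a b : a <= npair a b /\ b <= npair a b.
Proof.
have h := ltn_expl a (isT : 1 < 2); have h' := npair_gt0 a b; rewrite /npair.
split; nia.
Qed.

Lemma npair_mono a b a' b' : a <= a' -> b <= b' -> npair a b <= npair a' b'.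
Proof. by move=> ha hb; rewrite leq_sub2r // leq_mul ?leq_exp2l // ltnS leq_double. Qed.

Lemma npair_inj a b a' b' : npair a b = npair a' b' -> a = a' /\ b = b'.
Proof.
rewrite /npair => e.
have {e} : 2 ^ a * b.*2.+1 = 2 ^ a' * b'.*2.+1.
  by have := npair_gt0 a b; have := npair_gt0 a' b'; lia.
elim: a a' => [|a IH] [|a']; rewrite ?expn0 ?mul1n ?expnS; try lia.
by move=> e; have [] := IH a' _; [lia | move=> -> ->].
Qed.

Lemma npair_surj N : exists a b, N = npair a b.
Proof.
suff h M : 0 < M -> exists a b, M = 2 ^ a * b.*2.+1.
  by have [a [b e]] := h N.+1 isT; exists a, b; rewrite /npair -e subn1.
have [k] := ubnP M; elim: k M => // k IH M hk hM.
case: (boolP (odd M)) => ho.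
  by exists 0, M./2; rewrite mul1n -[LHS]odd_double_half ho.
have e : M = M./2.*2 by rewrite -[LHS]odd_double_half (negbTE ho).
have [||a [b e']] := IH M./2; [lia | lia |].
by exists a.+1, b; rewrite {1}e e' expnS -mul2n mulnA.
Qed.

Lemma enc_list_inj : injective enc_list.
Proof.
elim=> [|x l IH] [|y l'] //= [] /npair_inj [-> /IH ->] //.
Qed.

Lemma enc_list_surj N : exists l, N = enc_list l.
Proof.
have [k] := ubnP N; elim: k N => // k IH [|N] hk; first by exists [::].
have [a [b e]] := npair_surj N; have [_ hb] := npair_ge a b.
have [|l el] := IH b; first lia.
by exists (a :: l); rewrite /= -el -e.
Qed.

Lemma map_enc_list_surj ls : exists lls, ls = map enc_list lls.
Proof.
elim: ls => [|N ls [lls ->]]; first by exists [::].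
by have [l ->] := enc_list_surj N; exists (l :: lls).
Qed.

(** Every number codes an automaton, so a search over numbers needs no test for valid codes. *)
Lemma enc_dfa_surj e : exists D, e = enc_dfa D.
Proof.
have [a [b ->]] := npair_surj e.
have [f ->] := enc_list_surj b; have [ls ->] := enc_list_surj a.
by have [t ->] := map_enc_list_surj ls; exists (DFA t f).
Qed.

Lemma nth_le_enc_list l i : nth 0 l i <= enc_list l.
Proof.
elim: l i => [|x l IH] [|i] //=; have [h1 h2] := npair_ge x (enc_list l); first lia.
by have := IH i; lia.
Qed.

(** Every state reached is at most the code of the automaton, so the code bounds the number of
    states. *)
Lemma dtable_le D q a : nth 0 (nth [::] (dtable D) q) a <= enc_dfa D.
Proof.
apply: leq_trans (nth_le_enc_list _ _) _.
have [h1 _] := npair_ge (enc_list (map enc_list (dtable D))) (enc_list (finals D)).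
apply: leq_trans h1; apply: leq_trans (nth_le_enc_list _ q).
case: (ltnP q (size (dtable D))) => h; first by rewrite (nth_map [::]).
by rewrite nth_default.
Qed.

(** This is the code of [nseq s M]. *)
Fixpoint enc_list_bound M s := if s is s'.+1 then (npair M (enc_list_bound M s')).+1 else 0.

Lemma enc_list_le M s l : size l <= s -> all (fun x => x <= M) l -> enc_list l <= enc_list_bound M s.
Proof.
elim: s l => [|s IH] [|x l] //= hs /andP [hx hl].
by rewrite ltnS npair_mono // IH.
Qed.

Definition enc_dfa_bound al s :=
  npair (enc_list_bound (enc_list_bound s al) s) (enc_list_bound s s).

(** * Automata whose states are listed in a sequence *)

Section ListDfa.

Variables (T : eqType) (q0 : T) (qs : seq T) (step : T -> nat -> T) (F : pred T) (m k : nat).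

Hypothesis hhead : ohead qs = Some q0.
Hypothesis hstep : forall q a, q \in qs -> a < m + k -> step q a \in qs.

(** A state is replaced by its index in [qs]; since runs start in state 0, [q0] has to be the
    head. *)
Definition list_dfa :=
  DFA [seq [seq index (step q a) qs | a <- iota 0 (m + k)] | q <- qs]
      [seq index q qs | q <- qs & F q].

Lemma list_dfa_lang w : lang m k list_dfa w <-> alph_word m k w /\ F (foldl step q0 w).
Proof.
have hrun q v : q \in qs -> alph_word m k v ->
  foldl (fun q a => nth 0 (nth [::] (dtable list_dfa) q) a) (index q qs) v =
    index (foldl step q v) qs /\ foldl step q v \in qs.
  elim: v q => [|a v IH] q hq //= /andP [ha hv].
  rewrite (nth_map q0) ?index_mem // nth_index //.
  rewrite (nth_map 0) ?size_iota // nth_iota // add0n.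
  by apply: IH => //; apply: hstep.
have [h0 e0] : q0 \in qs /\ 0 = index q0 qs.
  by case: (qs) hhead => //= q l [->]; rewrite inE eqxx.
have hF v : alph_word m k v -> (dfa_run list_dfa v \in finals list_dfa) = F (foldl step q0 v).
  move=> hv; have [e hq] := hrun _ _ h0 hv; rewrite -e0 in e; rewrite /dfa_run e.
  apply/mapP/idP => [[q hqF e']|hFq].
    by move: hqF; rewrite mem_filter -(nth_index q0 hq) e' => /andP [h ?]; rewrite nth_index.
  by exists (foldl step q0 v) => //; rewrite mem_filter hFq.
by rewrite /lang; split=> -[hv h]; split=> //; move: h; rewrite hF.
Qed.

Lemma enc_list_dfa : enc_dfa list_dfa <= enc_dfa_bound (m + k) (size qs).
Proof.
apply: npair_mono; apply: enc_list_le; rewrite ?size_map //.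
- rewrite all_map; apply/allP => x /mapP [q hq ->] /=.
  apply: enc_list_le; rewrite ?size_map ?size_iota //.
  rewrite all_map; apply/allP => a; rewrite mem_iota add0n => /= ha.
  exact: index_size.
- by rewrite size_filter count_size.
rewrite all_map; apply/allP => q _; exact: index_size.
Qed.

End ListDfa.

(** * Automata with a finite type of states *)

Section OptionAutomaton.

Variables (m k N : nat) (D : dfa).
Hypothesis hN : enc_dfa D <= N.

(** [None] is a sink for letters outside the alphabet. [N] may exceed the code of [D], which lets
    two automata share one type of states. *)
Definition ostep (q : option 'I_N.+1) (a : nat) : option 'I_N.+1 :=
  if q is Some i then
    if a < m + k then Some (inord (nth 0 (nth [::] (dtable D) i) a)) else None
  else None.

Definition ofinal (q : option 'I_N.+1) : bool := if q is Some i then (i : nat) \in finals D else false.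

Lemma ostep_lang w : lang m k D w <-> ofinal (run ostep (Some ord0) w).
Proof.
have hNone v : run ostep None v = None by elim: v.
have h (q : 'I_N.+1) v : ofinal (run ostep (Some q) v) <->
    alph_word m k v /\ foldl (fun q a => nth 0 (nth [::] (dtable D) q) a) q v \in finals D.
  elim: v q => [|a v IH] q /=; first by split=> [|[]].
  case: ifP => ha /=; last by rewrite hNone; split=> // -[].
  rewrite IH inordK //.
  by rewrite ltnS (leq_trans (dtable_le _ _ _)).
by rewrite h.
Qed.

End OptionAutomaton.

(** * Explicit numerical bounds *)

Definition tau_card n c := 2 ^ (c * (c * c) ^ n.*2.+1).
Definition theta_card n c := 2 ^ ((c * c) ^ n.*2.+1).
Definition tau2_card n c := tau_card n c * tau_card n c.

Lemma card_sets (X : finType) : #|{: {set X}}| = 2 ^ #|X|.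
Proof. by rewrite -[LHS]cardsT -powersetT card_powerset cardsT. Qed.

Lemma tau_cardE (Q : finType) n :
  #|{: {set Q * n.*2.+1.-tuple (Q * Q)}}| = tau_card n #|Q|.
Proof. by rewrite card_sets card_prod card_tuple card_prod. Qed.

Lemma theta_cardE (Q : finType) n :
  #|{: {set n.*2.+1.-tuple (Q * Q)}}| = theta_card n #|Q|.
Proof. by rewrite card_sets card_tuple card_prod. Qed.

(** [c1] counts the states of the automaton of S, and [c2] those of the product of the automaton of
    T with a candidate of code [e]. *)
Definition check_bound N e :=
  let c1 := N.+2 in let c2 := N.+2 * e.+2 in
  (tau2_card N.+2 c1 * tau2_card N.+2 c2).*2 + theta_card N.+2 c1 * theta_card N.+2 c2.

(** Here and below, [loop_count], [window_len], [block_len], [lag_state_count] and [word_len] are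
    restated as arithmetic functions, for [n = N + 2] and automata with [N + 2] states. *)
Definition loop_bound N := tau2_card N.+2 N.+2 * N.+2 * N.+2.
Definition window_bound N l := l + N.+2 + N.+2.*2 * (loop_bound N).+1.
Definition block_bound N l :=
  window_bound N l + N.+2 * theta_card N.+2 N.+2 ^ (window_bound N l).+1.
Definition lag_bound al N := N.+2 * 2 * (num_words al N.+2).+1 * tau2_card N.+2 N.+2.
Fixpoint length_bound N l i := if i is i'.+1 then length_bound N (l + block_bound N l) i' else l.
Definition search_bound al N :=
  enc_dfa_bound al (num_words al (length_bound N (lag_bound al N) N.+2.*2).+1).

(** * Reduction to a bounded search for an automaton *)

Section Semantic.

Variables (m k : nat).

Lemma sem_track w : sem m w = (track m true w, track m false w).
Proof. by rewrite /sem /pi_i /pi_o; congr pair; apply: eq_filter => a /=; case: inSigma. Qed.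

Lemma sem_lang_related (Q : finType) (d : Q -> nat -> Q) i (F : pred Q) (L : language) X Y :
  (forall w, L w <-> F (run d i w)) -> sem_lang m L (X, Y) <-> related m d i F true X Y.
Proof.
move=> hL; split=> -[w]; last first.
  by move=> [h1 h2 h3]; exists w; rewrite sem_track h2 h3; split=> //; apply/hL.
by rewrite sem_track => -[/hL h1 [h2 h3]]; exists w.
Qed.

Lemma finType_regular (Q : finType) (d : Q -> nat -> Q) i (F : pred Q) (L : language) :
  (forall w, L w <-> F (run d i w)) -> (forall w, L w -> alph_word m k w) -> regular m k L.
Proof.
move=> hL ha; exists (list_dfa (i :: enum Q) d F m k) => w.
rewrite (@list_dfa_lang _ i) //.
  by split=> [h|[_ h]]; [split; [exact: ha | exact/hL] | exact/hL].
by move=> q a _ _; rewrite inE mem_enum orbT.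
Qed.

Definition included C (L1 L2 : language) :=
  forall w, size w <= C -> L1 w -> exists w', L2 w' /\ sem m w' = sem m w.

Lemma included_related (Q1 Q2 : finType) (d1 : Q1 -> nat -> Q1) i1 (F1 : pred Q1)
    (d2 : Q2 -> nat -> Q2) i2 (F2 : pred Q2) (L1 L2 : language) C :
  (forall w, L1 w <-> F1 (run d1 i1 w)) -> (forall w, L2 w <-> F2 (run d2 i2 w)) ->
  included C L1 L2 -> forall b X Y, size X + size Y <= C ->
  related m d1 i1 F1 b X Y -> related m d2 i2 F2 b X Y.
Proof.
move=> hL1 hL2 hin b X Y hC [w [hw hX hY]].
have [|w' [hw' e]] := hin w _ ((hL1 w).2 hw).
  by rewrite (size_track m b) hX hY.
exists w'; split; first exact/hL2.
  by rewrite -hX; case: (b); move: e; rewrite !sem_track => -[].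
by rewrite -hY; case: (b); move: e; rewrite !sem_track => -[].
Qed.

Variables (A B : dfa).
Hypotheses (hA : finite_shiftlag m (lang m k A)) (hB : finite_shiftlag m (lang m k B)).
Hypothesis hU : unambiguous m (lang m k B).

(** A common bound gives both automata the same type of states, whose cardinality [n] is also the
    lag threshold. *)
Let N := enc_dfa A + enc_dfa B.
Let n := N.+2.
Let Q := option 'I_N.+1.

Let card_Q : #|{: Q}| = n. Proof. by rewrite card_option card_ord. Qed.

Let stepA : Q -> nat -> Q := ostep m k A.
Let stepB : Q -> nat -> Q := ostep m k B.
Let finA : pred Q := ofinal A.
Let finB : pred Q := ofinal B.
Let q0 : Q := Some ord0.

Let langA w : lang m k A w <-> finA (run stepA q0 w).
Proof. by apply: ostep_lang; apply: leq_addr. Qed.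

Let langB w : lang m k B w <-> finB (run stepB q0 w).
Proof. by apply: ostep_lang; apply: leq_addl. Qed.

Let blkA : blocky_after_lag m stepA q0 finA n.
Proof.
move=> b u v huv; apply: (finite_shiftlag_blocky langA _ hA); first by rewrite card_Q.
exact/langA.
Qed.

Let blkB : blocky_after_lag m stepB q0 finB n.
Proof.
move=> b u v huv; apply: (finite_shiftlag_blocky langB _ hB); first by rewrite card_Q.
exact/langB.
Qed.

Section Product.

Variable D : dfa.

Let Q2 := (Q * option 'I_(enc_dfa D).+1)%type.
Let step2 (q : Q2) a : Q2 := (stepB q.1 a, ostep m k D q.2 a).
Let fin2 : pred Q2 := fun q => finB q.1 && ofinal D q.2.
Let i2 : Q2 := (q0, Some ord0).

Definition inter w := lang m k B w /\ lang m k D w.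

Let run2 q w : run step2 q w = (run stepB q.1 w, run (ostep m k D) q.2 w).
Proof. by elim: w q => [|a w IH] [q r] //=; rewrite IH. Qed.

Let lang2 w : inter w <-> fin2 (run step2 i2 w).
Proof.
rewrite run2 /fin2 /= /inter langB (@ostep_lang m k (enc_dfa D)) //.
by split=> [[-> ->]|/andP].
Qed.

Let blk2 : blocky_after_lag m step2 i2 fin2 n.
Proof.
move=> b u v /lang2 [huv _]; apply: blkB; exact/langB.
Qed.

Let card_Q2 : #|{: Q2}| = N.+2 * (enc_dfa D).+2.
Proof. by rewrite card_prod !card_option !card_ord. Qed.

Lemma included_sem : included (check_bound N (enc_dfa D)) (lang m k A) inter ->
  included (check_bound N (enc_dfa D)) inter (lang m k A) ->
  forall p, sem_lang m (lang m k A) p <-> sem_lang m inter p.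
Proof.
move=> h1 h2.
have e1 : (tau_count n Q Q2).*2 + theta_count n Q Q2 = check_bound N (enc_dfa D).
  rewrite /tau_count /theta_count !card_prod !tau_cardE !theta_cardE card_Q card_Q2 //.
have e2 : (tau_count n Q2 Q).*2 + theta_count n Q2 Q = check_bound N (enc_dfa D).
  rewrite /tau_count /theta_count !card_prod !tau_cardE !theta_cardE card_Q card_Q2.
  by rewrite [X in X.*2 + _]mulnC [X in _ + X]mulnC.
move=> [X Y]; rewrite (sem_lang_related _ _ langA) (sem_lang_related _ _ lang2).
split; apply: related_incl; [exact: blkA | exact: blk2 | | exact: blk2 | exact: blkA | ].
  by rewrite e1; apply: included_related langA lang2 h1.
by rewrite e2; apply: included_related lang2 langA h2.
Qed.

Lemma inter_regular : regular m k inter.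
Proof. by apply: finType_regular lang2 _ => w [[]]. Qed.

End Product.

Lemma included_in_Rel D : included (check_bound N (enc_dfa D)) (lang m k A) (inter D) ->
  included (check_bound N (enc_dfa D)) (inter D) (lang m k A) ->
  in_Rel m k (lang m k B) (sem_lang m (lang m k A)).
Proof.
move=> h1 h2; exists (inter D); split; first exact: inter_regular.
split; first by move=> w [].
exact: included_sem.
Qed.

Lemma in_Rel_dfa : in_Rel m k (lang m k B) (sem_lang m (lang m k A)) ->
  exists D, enc_dfa D <= search_bound (m + k) N /\
    forall C, included C (lang m k A) (inter D) /\ included C (inter D) (lang m k A).
Proof.
move=> [T' [[D0 hD0] [hT'B hT'A]]].
pose stepD := ostep m k (N := enc_dfa D0) D0.
pose finD := ofinal (N := enc_dfa D0) D0.
pose i0 : option 'I_(enc_dfa D0).+1 := Some ord0.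
have hT' w : T' w <-> finD (run stepD i0 w) by rewrite hD0; apply: ostep_lang.
have hR w : finD (run stepD i0 w) <-> finB (run stepB q0 w) /\
    related m stepA q0 finA true (track m true w) (track m false w).
  rewrite -hT' -langB -(sem_lang_related _ _ langA) hT'A -sem_track.
  split=> [hw|[hw [w' [hw' e]]]]; first by split; [exact: hT'B | exists w].
  (* Unambiguity identifies the word of [T'] that realises the pair with [w] itself; thus [T']
     contains every word of T whose pair lies in the relation. *)
  suff <- : w' = w by [].
  apply: contrapT => /(hU (hT'B _ hw') hw); exact.
have eK : loop_count n Q Q = loop_bound N by rewrite /loop_count !card_prod tau_cardE card_Q.
have eA l : window_len n Q Q l = window_bound N l by rewrite /window_len eK.
have eG l : block_len n Q Q l = block_bound N l.
  by rewrite /block_len card_prod card_ffun card_ord theta_cardE card_Q !eA.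
have eM : lag_state_count n Q Q (m + k) = lag_bound (m + k) N.
  by rewrite /lag_state_count !card_prod tau_cardE card_Q card_bool card_ord.
have eL l i : word_len n Q Q l i = length_bound N l i by elim: i l => //= i IH l; rewrite IH eG.
pose qs := words (m + k) (length_bound N (lag_bound (m + k) N) n.*2).+1.
(* The states of the small automaton are bounded representatives of Nerode classes. They are merely
   chosen, as only the size of the automaton matters. *)
have [rep hrep] : {rep : seq nat -> seq nat & forall u, alph_word m k u ->
    rep u \in qs /\ nerode stepD i0 finD u (rep u)}.
  apply: (@choice _ _ (fun u v => alph_word m k u -> v \in qs /\ nerode stepD i0 finD u v)) => u.
  case: (boolP (alph_word m k u)) => hu; last by exists [::].
  have [u' hu'] := nerode_words blkA blkB hR hu.
  by exists u' => _; rewrite /qs -eM -eL.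
pose step u a := rep (rcons u a).
pose fin u := finD (run stepD i0 u).
have hqs u : u \in qs -> alph_word m k u by rewrite mem_words => /andP [].
have hstep u a : u \in qs -> a < m + k -> step u a \in qs.
  by move=> /hqs hu ha; apply: (hrep _ _).1; rewrite /alph_word all_rcons ha.
have hrun w : alph_word m k w -> alph_word m k (foldl step [::] w) /\
    nerode stepD i0 finD w (foldl step [::] w).
  elim/last_ind: w => [|w a IH]; first by split.
  rewrite {1}/alph_word all_rcons foldl_rcons => /andP [ha /IH [h1 h2]].
  have h3 : alph_word m k (rcons (foldl step [::] w) a) by rewrite /alph_word all_rcons ha.
  have [h4 h5] := hrep _ h3; split; first exact: hqs.
  by move=> z; rewrite -h5 !cat_rcons; apply: h2.
have hhead : ohead qs = Some [::] by [].
exists (list_dfa qs step fin m k); split.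
  by have := enc_list_dfa qs step fin m k; rewrite size_words.
have hL w : lang m k (list_dfa qs step fin m k) w <-> T' w.
  rewrite (list_dfa_lang fin hhead hstep) hT' /fin; split=> [[ha]|hw].
    by have [_ /(_ [::])] := hrun _ ha; rewrite !cats0 => ->.
  have ha : alph_word m k w by move/hT': hw => /hD0 [].
  by split=> //; have [_ /(_ [::])] := hrun _ ha; rewrite !cats0 => <-.
move=> C; split=> w _.
  move=> hw; have [|w' [hw' e]] := (hT'A (sem m w)).1; first by exists w.
  by exists w'; split=> //; split; [exact: hT'B | apply/hL].
move=> [_ /hL hw]; have [|w' [hw' e]] := (hT'A (sem m w)).2; first by exists w.
by exists w'.
Qed.

End Semantic.

(** * Computability *)

(** Booleans are covered through their coercion to [nat]. *)
Definition cpt (k : nat) (f : seq nat -> nat) :=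
  exists c, forall v, size v = k -> eval c v (f v).

Lemma cpt_ext k f g : (forall v, f v = g v) -> cpt k f -> cpt k g.
Proof. by move=> e [c hc]; exists c => v hv; rewrite -e; apply: hc. Qed.

Lemma cpt_nth k i : cpt k (fun v => nth 0 v i).
Proof. by exists (CProj i) => v _; constructor. Qed.

(** Turns an access to the parameters below the two extra arguments of a recursion step into a plain
    projection. *)
Lemma cpt_behead k (h : seq nat -> seq nat) i :
  cpt k (fun v => nth 0 (h v) i.+1) -> cpt k (fun v => nth 0 (behead (h v)) i).
Proof. by apply: cpt_ext => v; rewrite nth_behead. Qed.

Lemma cpt_S k f : cpt k f -> cpt k (fun v => (f v).+1).
Proof.
move=> [c hc]; exists (CComp CSucc [:: c]) => v hv.
by apply: (@eComp _ _ _ [:: f v]); [constructor; [exact: hc | constructor] | constructor].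
Qed.

Lemma cpt_const k c : cpt k (fun=> c).
Proof.
elim: c => [|c IH]; last exact: cpt_S.
by exists CZero => v _; constructor.
Qed.

Lemma eval_proj v : List.Forall2 (fun g y => eval g v y) [seq CProj i | i <- iota 0 (size v)] v.
Proof.
suff h s i : (forall j, nth 0 s j = nth 0 v (i + j)) ->
    List.Forall2 (fun g y => eval g v y) [seq CProj j | j <- iota i (size s)] s.
  by apply: h => j.
elim: s i => [|x s IH] i h /=; constructor.
  by have /= := h 0; rewrite addn0 => ->; constructor.
by apply: IH => j; rewrite addSnnS; apply: (h j.+1).
Qed.

(** In the step, the vector starts with the counter and the previous value; the parameters are what
    two [behead] leave. *)
Lemma cpt_rec k (F : nat -> seq nat -> nat) n f g :
  (forall v, F 0 v = f v) -> (forall i v, F i.+1 v = g i (F i v) v) ->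
  cpt k n -> cpt k f -> cpt k.+2 (fun v => g (nth 0 v 0) (nth 0 v 1) (behead (behead v))) ->
  cpt k (fun v => F (n v) v).
Proof.
move=> h0 hS [cn hn] [cf hf] [cg hg].
exists (CComp (CPrec cf cg) (cn :: [seq CProj i | i <- iota 0 k])) => v hv.
apply: (@eComp _ _ _ (n v :: v)).
  by constructor; [exact: hn | rewrite -hv; apply: eval_proj].
elim: (n v) => [|i IH]; first by rewrite h0; constructor; apply: hf.
rewrite hS; apply: ePrecS IH _.
by have := hg [:: i, F i v & v]; rewrite /= hv; apply.
Qed.

Lemma cpt_comp1 (f : nat -> nat) : cpt 1 (fun v => f (nth 0 v 0)) ->
  forall k g, cpt k g -> cpt k (fun v => f (g v)).
Proof.
move=> [c hc] k g [cg hg]; exists (CComp c [:: cg]) => v hv.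
apply: (@eComp _ _ _ [:: g v]); last exact: hc [:: g v] _.
by do ![constructor]; apply: hg.
Qed.

Lemma cpt_comp2 (f : nat -> nat -> nat) : cpt 2 (fun v => f (nth 0 v 0) (nth 0 v 1)) ->
  forall k g h, cpt k g -> cpt k h -> cpt k (fun v => f (g v) (h v)).
Proof.
move=> [c hc] k g h [cg hg] [ch hh]; exists (CComp c [:: cg; ch]) => v hv.
apply: (@eComp _ _ _ [:: g v; h v]); last exact: hc [:: g v; h v] _.
by constructor; [exact: hg | constructor; [exact: hh | constructor]].
Qed.

Lemma cpt_comp3 (f : nat -> nat -> nat -> nat) :
  cpt 3 (fun v => f (nth 0 v 0) (nth 0 v 1) (nth 0 v 2)) ->
  forall k g h l, cpt k g -> cpt k h -> cpt k l -> cpt k (fun v => f (g v) (h v) (l v)).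
Proof.
move=> [c hc] k g h l [cg hg] [ch hh] [cl hl]; exists (CComp c [:: cg; ch; cl]) => v hv.
apply: (@eComp _ _ _ [:: g v; h v; l v]); last exact: hc [:: g v; h v; l v] _.
constructor; [exact: hg | constructor; [exact: hh | constructor; [exact: hl | constructor]]].
Qed.

Lemma cpt_pred k f : cpt k f -> cpt k (fun v => (f v).-1).
Proof.
move=> hf; apply: (@cpt_rec k (fun i _ => i.-1) f (fun=> 0) (fun i _ _ => i)) => //.
  exact: cpt_const.
exact: cpt_nth.
Qed.

Lemma cpt_add k f g : cpt k f -> cpt k g -> cpt k (fun v => f v + g v).
Proof.
apply: (cpt_comp2 (f := addn)).
apply: (@cpt_rec 2 (fun i v => i + nth 0 v 1) (fun v => nth 0 v 0) (fun v => nth 0 v 1)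
  (fun _ r _ => r.+1)) => //; do ?apply: cpt_S; exact: cpt_nth.
Qed.

Lemma cpt_mul k f g : cpt k f -> cpt k g -> cpt k (fun v => f v * g v).
Proof.
apply: (cpt_comp2 (f := muln)).
apply: (@cpt_rec 2 (fun i v => i * nth 0 v 1) (fun v => nth 0 v 0) (fun=> 0)
  (fun _ r v => nth 0 v 1 + r)) => //.
- exact: cpt_nth.
- exact: cpt_const.
by apply: cpt_add; [do 2 apply: cpt_behead; apply: cpt_nth | apply: cpt_nth].
Qed.

Lemma cpt_sub k f g : cpt k f -> cpt k g -> cpt k (fun v => f v - g v).
Proof.
apply: (cpt_comp2 (f := subn)).
apply: (@cpt_rec 2 (fun i v => nth 0 v 0 - i) (fun v => nth 0 v 1) (fun v => nth 0 v 0)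
  (fun _ r _ => r.-1)) => //.
- by move=> v; rewrite subn0.
- by move=> i v; rewrite subnS.
- exact: cpt_nth.
- exact: cpt_nth.
by apply: cpt_pred; apply: cpt_nth.
Qed.

Lemma cpt_exp k f g : cpt k f -> cpt k g -> cpt k (fun v => f v ^ g v).
Proof.
apply: (cpt_comp2 (f := expn)).
apply: (@cpt_rec 2 (fun i v => nth 0 v 0 ^ i) (fun v => nth 0 v 1) (fun=> 1)
  (fun _ r v => nth 0 v 0 * r)) => //.
- by move=> i v; rewrite expnS.
- exact: cpt_nth.
- exact: cpt_const.
by apply: cpt_mul; [do 2 apply: cpt_behead; apply: cpt_nth | apply: cpt_nth].
Qed.

Lemma cpt_double k f : cpt k f -> cpt k (fun v => (f v).*2).
Proof. by move=> hf; apply: (cpt_ext (fun v => addnn (f v))); apply: cpt_add. Qed.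

Lemma cpt_leq k f g : cpt k f -> cpt k g -> cpt k (fun v => f v <= g v).
Proof.
move=> hf hg; apply: (@cpt_ext k (fun v => 1 - (f v - g v))) => [v|].
  by rewrite /leq; case: (f v - g v).
by apply: cpt_sub; [apply: cpt_const | apply: cpt_sub].
Qed.

Lemma cpt_and k (p q : seq nat -> bool) : cpt k p -> cpt k q -> cpt k (fun v => p v && q v).
Proof.
move=> hp hq; apply: (@cpt_ext k (fun v => p v * q v)); last exact: cpt_mul.
by move=> v; case: (p v); case: (q v).
Qed.

Lemma cpt_neg k (p : seq nat -> bool) : cpt k p -> cpt k (fun v => ~~ p v).
Proof.
move=> hp; apply: (@cpt_ext k (fun v => 1 - p v)); first by move=> v; case: (p v).
by apply: cpt_sub => //; apply: cpt_const.
Qed.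

Lemma cpt_or k (p q : seq nat -> bool) : cpt k p -> cpt k q -> cpt k (fun v => p v || q v).
Proof.
move=> hp hq; apply: (@cpt_ext k (fun v => ~~ (~~ p v && ~~ q v))).
  by move=> v; case: (p v); case: (q v).
by apply: cpt_neg; apply: cpt_and; apply: cpt_neg.
Qed.

Lemma cpt_imply k (p q : seq nat -> bool) : cpt k p -> cpt k q -> cpt k (fun v => p v ==> q v).
Proof.
move=> hp hq; apply: (@cpt_ext k (fun v => ~~ p v || q v)).
  by move=> v; rewrite implybE.
by apply: cpt_or => //; apply: cpt_neg.
Qed.

Lemma cpt_eq k f g : cpt k f -> cpt k g -> cpt k (fun v => f v == g v).
Proof.
move=> hf hg; apply: (@cpt_ext k (fun v => (f v <= g v) && (g v <= f v))).
  by move=> v; rewrite eqn_leq.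
by apply: cpt_and; apply: cpt_leq.
Qed.

Lemma cpt_if k (p : seq nat -> bool) f g : cpt k p -> cpt k f -> cpt k g ->
  cpt k (fun v => if p v then f v else g v).
Proof.
move=> hp hf hg; apply: (@cpt_ext k (fun v => p v * f v + (~~ p v) * g v)).
  by move=> v; case: (p v); rewrite !mul0n !mul1n ?addn0.
by apply: cpt_add; apply: cpt_mul => //; apply: cpt_neg.
Qed.

Lemma cpt_has k n (P : nat -> seq nat -> bool) : cpt k n ->
  cpt k.+2 (fun v => P (nth 0 v 0) (behead (behead v))) ->
  cpt k (fun v => has (fun i => P i v) (iota 0 (n v))).
Proof.
move=> hn hP.
apply: (@cpt_rec k (fun i v => has (fun j => P j v) (iota 0 i)) n (fun=> 0)
  (fun i r v => (r == 1) || P i v)) => //.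
- by move=> i v; rewrite -{1}addn1 iotaD has_cat /= orbF; case: (has _ _).
- exact: cpt_const.
by apply: cpt_or => //; apply: cpt_eq; [apply: cpt_nth | apply: cpt_const].
Qed.

Lemma cpt_all k n (P : nat -> seq nat -> bool) : cpt k n ->
  cpt k.+2 (fun v => P (nth 0 v 0) (behead (behead v))) ->
  cpt k (fun v => all (fun i => P i v) (iota 0 (n v))).
Proof.
move=> hn hP; apply: (@cpt_ext k (fun v => ~~ has (fun i => ~~ P i v) (iota 0 (n v)))).
  by move=> v; rewrite -all_predC; congr nat_of_bool; apply: eq_all => i /=; rewrite negbK.
by apply: cpt_neg; apply: cpt_has => //; apply: cpt_neg.
Qed.

(** While nothing has been found, [find] on [iota 0 i] returns [i]; a value [r < i] is thus a
    success already obtained. *)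
Lemma cpt_find k n (P : nat -> seq nat -> bool) : cpt k n ->
  cpt k.+2 (fun v => P (nth 0 v 0) (behead (behead v))) ->
  cpt k (fun v => find (fun i => P i v) (iota 0 (n v))).
Proof.
move=> hn hP.
apply: (@cpt_rec k (fun i v => find (fun j => P j v) (iota 0 i)) n (fun=> 0)
  (fun i r v => if r < i then r else i + ~~ P i v)) => //.
- move=> i v; rewrite -{1}addn1 iotaD find_cat has_find size_iota /=.
  by case: ifP => //; case: (P i v).
- exact: cpt_const.
apply: cpt_if; first by apply: cpt_leq; [apply: cpt_S; apply: cpt_nth | apply: cpt_nth].
  exact: cpt_nth.
by apply: cpt_add; [apply: cpt_nth | apply: cpt_neg].
Qed.

Lemma find_iota (p : pred nat) c n : p c -> (forall i, i < c -> ~~ p i) -> c < n ->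
  find p (iota 0 n) = c.
Proof.
move=> hc hl hn; have -> : n = c + (n - c).-1.+1 by lia.
rewrite iotaD find_cat /= add0n hc size_iota addn0.
rewrite (_ : has _ _ = false) //; apply/hasPn => i; rewrite mem_iota; exact: hl.
Qed.

Create HintDb cpt discriminated.
#[local] Hint Constants Opaque : cpt.
#[local] Hint Resolve cpt_const cpt_nth cpt_behead cpt_S cpt_double cpt_pred cpt_add cpt_mul cpt_sub
  cpt_exp cpt_and cpt_imply cpt_or cpt_neg cpt_leq cpt_eq cpt_if : cpt.

Ltac cpt_tac := auto 100 with cpt nocore.

(** * Decoding of pairs, lists and runs *)

Lemma cpt_npair k f g : cpt k f -> cpt k g -> cpt k (fun v => npair (f v) (g v)).
Proof. by move=> hf hg; rewrite /npair; cpt_tac. Qed.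
#[local] Hint Resolve cpt_npair : cpt.

(** Both components of a pair are at most its code, so a bounded search recovers them. *)
Definition fstp N := find (fun a => has (fun b => npair a b == N) (iota 0 N.+1)) (iota 0 N.+1).
Definition sndp N := find (fun b => has (fun a => npair a b == N) (iota 0 N.+1)) (iota 0 N.+1).

Lemma fstp_npair a b : fstp (npair a b) = a.
Proof.
have [h1 h2] := npair_ge a b; apply: find_iota; last by rewrite ltnS.
  by apply/hasP; exists b; rewrite ?mem_iota.
move=> i hi; apply/hasPn => j _; apply/eqP => /npair_inj [e _].
by rewrite e ltnn in hi.
Qed.

Lemma sndp_npair a b : sndp (npair a b) = b.
Proof.
have [h1 h2] := npair_ge a b; apply: find_iota; last by rewrite ltnS.
  by apply/hasP; exists a; rewrite ?mem_iota.
move=> i hi; apply/hasPn => j _; apply/eqP => /npair_inj [_ e].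
by rewrite e ltnn in hi.
Qed.

Lemma cpt_fstp k f : cpt k f -> cpt k (fun v => fstp (f v)).
Proof.
apply: (cpt_comp1 (f := fstp)).
apply: (@cpt_find 1 _ (fun a v => has (fun b => npair a b == nth 0 v 0) (iota 0 (nth 0 v 0).+1))).
  by cpt_tac.
apply: (@cpt_has 3 _ (fun b v => npair (nth 0 v 0) b == nth 0 (behead (behead v)) 0)).
  by cpt_tac.
by cpt_tac.
Qed.
#[local] Hint Resolve cpt_fstp : cpt.

Lemma cpt_sndp k f : cpt k f -> cpt k (fun v => sndp (f v)).
Proof.
apply: (cpt_comp1 (f := sndp)).
apply: (@cpt_find 1 _ (fun b v => has (fun a => npair a b == nth 0 v 0) (iota 0 (nth 0 v 0).+1))).
  by cpt_tac.
apply: (@cpt_has 3 _ (fun a v => npair a (nth 0 v 0) == nth 0 (behead (behead v)) 0)).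
  by cpt_tac.
by cpt_tac.
Qed.
#[local] Hint Resolve cpt_sndp : cpt.

(* The code [0] of the empty list needs no special case, because [npair 0 0 = 0]. *)
Definition headc x := fstp x.-1.
Definition tailc x := sndp x.-1.
Definition dropc i x := iter i tailc x.
Definition nthc x i := headc (dropc i x).
Definition sizec x := find (fun i => dropc i x == 0) (iota 0 x.+1).

Lemma headcE l : headc (enc_list l) = head 0 l.
Proof. case: l => [|x l]; [exact: (fstp_npair 0 0) | exact: fstp_npair]. Qed.

Lemma tailcE l : tailc (enc_list l) = enc_list (behead l).
Proof. case: l => [|x l]; [exact: (sndp_npair 0 0) | exact: sndp_npair]. Qed.

Lemma dropcE i l : dropc i (enc_list l) = enc_list (drop i l).
Proof.
elim: i => [|i IH]; first by rewrite drop0.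
by rewrite /dropc iterS -/(dropc i _) IH tailcE -drop1 drop_drop add1n.
Qed.

Lemma nthcE l i : nthc (enc_list l) i = nth 0 l i.
Proof. by rewrite /nthc dropcE headcE -nth0 nth_drop addn0. Qed.

Lemma nthc_map ls i : nthc (enc_list (map enc_list ls)) i = enc_list (nth [::] ls i).
Proof.
rewrite nthcE; case: (ltnP i (size ls)) => h; first by rewrite (nth_map [::]).
by rewrite !nth_default ?size_map.
Qed.

Lemma size_enc_list l : size l <= enc_list l.
Proof. by elim: l => //= x l IH; rewrite ltnS (leq_trans IH) //; case: (npair_ge x (enc_list l)). Qed.

Lemma sizecE l : sizec (enc_list l) = size l.
Proof.
apply: find_iota.
- by rewrite dropcE drop_size.
- move=> i hi; rewrite dropcE; case: (drop i l) (size_drop i l) => //= e.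
  by move: hi; rewrite -subn_gt0 -e.
by rewrite ltnS size_enc_list.
Qed.

Lemma cpt_headc k f : cpt k f -> cpt k (fun v => headc (f v)).
Proof. by move=> h; apply: cpt_fstp; apply: cpt_pred. Qed.
#[local] Hint Resolve cpt_headc : cpt.

Lemma cpt_tailc k f : cpt k f -> cpt k (fun v => tailc (f v)).
Proof. by move=> h; apply: cpt_sndp; apply: cpt_pred. Qed.
#[local] Hint Resolve cpt_tailc : cpt.

Lemma cpt_dropc k f g : cpt k f -> cpt k g -> cpt k (fun v => dropc (f v) (g v)).
Proof.
move=> hf; move: k f g hf; apply: (cpt_comp2 (f := dropc)).
apply: (@cpt_rec 2 (fun i v => dropc i (nth 0 v 1)) _ (fun v => nth 0 v 1) (fun _ r _ => tailc r)) => //.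
- by cpt_tac.
- by cpt_tac.
by cpt_tac.
Qed.
#[local] Hint Resolve cpt_dropc : cpt.

Lemma cpt_nthc k f g : cpt k f -> cpt k g -> cpt k (fun v => nthc (f v) (g v)).
Proof. by move=> hf hg; apply: cpt_headc; apply: cpt_dropc. Qed.
#[local] Hint Resolve cpt_nthc : cpt.

Lemma cpt_sizec k f : cpt k f -> cpt k (fun v => sizec (f v)).
Proof.
apply: (cpt_comp1 (f := sizec)).
apply: (@cpt_find 1 _ (fun i v => dropc i (nth 0 v 0) == 0)); first by cpt_tac.
by cpt_tac.
Qed.
#[local] Hint Resolve cpt_sizec : cpt.

Definition runc d x i := iteri i (fun j q => nthc (nthc (fstp d) q) (nthc x j)) 0.

Lemma runcE D w i : i <= size w -> runc (enc_dfa D) (enc_list w) i = dfa_run D (take i w).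
Proof.
elim: i => [|i IH] h; first by rewrite take0.
rewrite /runc /= -/(runc _ _ _) (IH (ltnW h)) fstp_npair nthc_map !nthcE.
by rewrite (take_nth 0 h) /dfa_run -cats1 foldl_cat.
Qed.

Lemma cpt_runc k f g h : cpt k f -> cpt k g -> cpt k h -> cpt k (fun v => runc (f v) (g v) (h v)).
Proof.
move=> hf; move: k f g h hf; apply: (cpt_comp3 (f := runc)).
apply: (@cpt_rec 3 (fun i v => runc (nth 0 v 0) (nth 0 v 1) i) _ (fun=> 0)
  (fun j q v => nthc (nthc (fstp (nth 0 v 0)) q) (nthc (nth 0 v 1) j))) => //; by cpt_tac.
Qed.
#[local] Hint Resolve cpt_runc : cpt.

(** * Acceptance and equality of projections on codes *)

Section Accept.

Variables (m k : nat).

Definition accept d x :=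
  all (fun i => nthc x i < m + k) (iota 0 (sizec x)) &&
  has (fun i => nthc (sndp d) i == runc d x (sizec x)) (iota 0 (sizec (sndp d))).

Lemma acceptP D w : reflect (lang m k D w) (accept (enc_dfa D) (enc_list w)).
Proof.
rewrite /accept sizecE runcE // take_size sndp_npair sizecE.
apply: (iffP andP) => -[h1 h2]; split.
- apply/(all_nthP 0) => i hi; move/allP: h1 => /(_ i); rewrite mem_iota nthcE; exact.
- case/hasP: h2 => i; rewrite mem_iota nthcE => /= hi /eqP <-; exact: mem_nth.
- apply/allP => i; rewrite mem_iota nthcE => /= hi; exact: (all_nthP 0 h1).
apply/hasP; exists (index (dfa_run D w) (finals D)).
  by rewrite mem_iota index_mem.
by rewrite nthcE nth_index.
Qed.

Lemma cpt_accept r f g : cpt r f -> cpt r g -> cpt r (fun v => accept (f v) (g v)).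
Proof.
move=> hf; move: r f g hf; apply: (cpt_comp2 (f := fun d x => nat_of_bool (accept d x))).
apply: cpt_and.
  apply: (@cpt_all 2 _ (fun i v => nthc (nth 0 v 1) i < m + k)).
    by cpt_tac.
  by cpt_tac.
apply: (@cpt_has 2 _ (fun i v => nthc (sndp (nth 0 v 0)) i ==
  runc (nth 0 v 0) (nth 0 v 1) (sizec (nth 0 v 1)))).
  by cpt_tac.
by cpt_tac.
Qed.
#[local] Hint Resolve cpt_accept : cpt.

(* The projections are accumulated from left to right, so that they come out reversed. *)
Definition trackc b x i := iteri i (fun j r =>
  if (nthc x j < m) == b then (npair (nthc x j) r).+1 else r) 0.

Lemma trackcE b w i : i <= size w -> trackc b (enc_list w) i = enc_list (rev (track m b (take i w))).
Proof.
elim: i => [|i IH] h; first by rewrite take0.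
rewrite (take_nth 0 h) -cats1 track_cat rev_cat /trackc /= -/(trackc _ _ _) (IH (ltnW h)) nthcE.
by rewrite /inSigma; case: ifP.
Qed.

Lemma cpt_trackc r b f g : cpt r f -> cpt r g -> cpt r (fun v => trackc b (f v) (g v)).
Proof.
move=> hf; move: r f g hf; apply: (cpt_comp2 (f := trackc b)).
apply: (@cpt_rec 2 (fun i v => trackc b (nth 0 v 0) i) _ (fun=> 0)
  (fun j r v => if (nthc (nth 0 v 0) j < m) == b then (npair (nthc (nth 0 v 0) j) r).+1 else r)) => //;
  try by cpt_tac.
have h : cpt 4 (fun v => nthc (nth 0 (behead (behead v)) 0) (nth 0 v 0)).
  by cpt_tac.
apply: cpt_if; [|by cpt_tac|by cpt_tac].
(* Equality of booleans is read as equality of numbers, to which [cpt_eq] applies. *)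
apply: (@cpt_ext _ (fun v => ((nthc (nth 0 (behead (behead v)) 0) (nth 0 v 0) < m) : nat) == b)).
  by move=> v; case: (_ < m); case: b.
by cpt_tac.
Qed.
#[local] Hint Resolve cpt_trackc : cpt.

Definition same_sem x y :=
  (trackc true x (sizec x) == trackc true y (sizec y)) &&
  (trackc false x (sizec x) == trackc false y (sizec y)).

Lemma same_semP w w' : reflect (sem m w = sem m w') (same_sem (enc_list w) (enc_list w')).
Proof.
rewrite /same_sem !sizecE !trackcE // !take_size !sem_track.
apply: (iffP andP) => [[/eqP /enc_list_inj h1 /eqP /enc_list_inj h2]|[-> ->]]; last by rewrite !eqxx.
by rewrite -[track m true w]revK h1 -[track m false w]revK h2 !revK.
Qed.

Lemma cpt_same_sem r f g : cpt r f -> cpt r g -> cpt r (fun v => same_sem (f v) (g v)).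
Proof.
by move=> hf hg; apply: cpt_and; apply: cpt_eq; apply: cpt_trackc => //; apply: cpt_sizec.
Qed.

End Accept.

#[local] Hint Resolve cpt_accept cpt_trackc cpt_same_sem : cpt.

(** * Computability of the bounds *)

Lemma cpt_tau_card k f g : cpt k f -> cpt k g -> cpt k (fun v => tau_card (f v) (g v)).
Proof. by move=> hf hg; rewrite /tau_card; cpt_tac. Qed.
#[local] Hint Resolve cpt_tau_card : cpt.

Lemma cpt_tau2_card k f g : cpt k f -> cpt k g -> cpt k (fun v => tau2_card (f v) (g v)).
Proof. by move=> hf hg; apply: cpt_mul; apply: cpt_tau_card. Qed.
#[local] Hint Resolve cpt_tau2_card : cpt.

Lemma cpt_theta_card k f g : cpt k f -> cpt k g -> cpt k (fun v => theta_card (f v) (g v)).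
Proof. by move=> hf hg; rewrite /theta_card; cpt_tac. Qed.
#[local] Hint Resolve cpt_theta_card : cpt.

Lemma cpt_check_bound k f g : cpt k f -> cpt k g -> cpt k (fun v => check_bound (f v) (g v)).
Proof.
move=> hf hg; rewrite /check_bound /=.
by cpt_tac.
Qed.
#[local] Hint Resolve cpt_check_bound : cpt.

Lemma cpt_window_bound k f g : cpt k f -> cpt k g -> cpt k (fun v => window_bound (f v) (g v)).
Proof.
move=> hf hg; rewrite /window_bound /loop_bound.
by cpt_tac.
Qed.
#[local] Hint Resolve cpt_window_bound : cpt.

Lemma cpt_block_bound k f g : cpt k f -> cpt k g -> cpt k (fun v => block_bound (f v) (g v)).
Proof.
move=> hf hg; rewrite /block_bound.
by cpt_tac.
Qed.
#[local] Hint Resolve cpt_block_bound : cpt.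

(** The definition changes its argument [l] in the recursive call, whereas [cpt_rec] keeps the
    parameters fixed and applies the last step outermost. *)
Lemma length_boundS N l i :
  length_bound N l i.+1 = length_bound N l i + block_bound N (length_bound N l i).
Proof. by elim: i l => // i IH l; rewrite -IH. Qed.

Lemma cpt_length_bound k f g h : cpt k f -> cpt k g -> cpt k h ->
  cpt k (fun v => length_bound (f v) (g v) (h v)).
Proof.
move=> hf; move: k f g h hf; apply: (cpt_comp3 (f := length_bound)).
apply: (@cpt_rec 3 (fun i v => length_bound (nth 0 v 0) (nth 0 v 1) i) _ (fun v => nth 0 v 1)
  (fun _ r v => r + block_bound (nth 0 v 0) r)) => //; try by cpt_tac.
by move=> i v; apply: length_boundS.
Qed.
#[local] Hint Resolve cpt_length_bound : cpt.

Lemma cpt_num_words k al f : cpt k f -> cpt k (fun v => num_words al (f v)).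
Proof.
move=> hf; apply: (@cpt_rec k (fun i _ => num_words al i) f (fun=> 1) (fun _ r _ => (al * r).+1)) => //; cpt_tac.
Qed.
#[local] Hint Resolve cpt_num_words : cpt.

Lemma cpt_lag_bound k al f : cpt k f -> cpt k (fun v => lag_bound al (f v)).
Proof.
move=> hf; rewrite /lag_bound.
by cpt_tac.
Qed.
#[local] Hint Resolve cpt_lag_bound : cpt.

Lemma cpt_enc_list_bound k f g : cpt k f -> cpt k g -> cpt k (fun v => enc_list_bound (f v) (g v)).
Proof.
move=> hf; move: k f g hf; apply: (cpt_comp2 (f := enc_list_bound)).
apply: (@cpt_rec 2 (fun i v => enc_list_bound (nth 0 v 0) i) _ (fun=> 0)
  (fun _ r v => (npair (nth 0 v 0) r).+1)) => //; by cpt_tac.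
Qed.
#[local] Hint Resolve cpt_enc_list_bound : cpt.

Lemma cpt_search_bound k al f : cpt k f -> cpt k (fun v => search_bound al (f v)).
Proof.
move=> hf; rewrite /search_bound /enc_dfa_bound.
by cpt_tac.
Qed.
#[local] Hint Resolve cpt_search_bound : cpt.

(** * The decision procedure *)

Section Decision.

Variables (m k : nat).

Local Notation accept := (accept m k).
Local Notation code_bound := (enc_list_bound (m + k)).

(** A word with the same projections as the word coded by [x] has the same length, which is at most
    [x]; hence the search bound. *)
Definition matched b e x :=
  has (fun y => accept b y && accept e y && same_sem m y x) (iota 0 (code_bound x).+1).

(** [matched a a] asks for membership in the language of [a] alone. *)
Definition equal_upto N a b e :=
  all (fun x => (accept a x ==> matched b e x) && (accept b x && accept e x ==> matched a a x))
    (iota 0 (code_bound (check_bound N e)).+1).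

Definition decide a b :=
  has (fun e => equal_upto (a + b) a b e) (iota 0 (search_bound (m + k) (a + b)).+1).

Lemma cpt_matched r f g h : cpt r f -> cpt r g -> cpt r h ->
  cpt r (fun v => matched (f v) (g v) (h v)).
Proof.
move=> hf; move: r f g h hf; apply: (cpt_comp3 (f := fun b e x => nat_of_bool (matched b e x))).
apply: (@cpt_has 3 _ (fun y v => accept (nth 0 v 0) y && accept (nth 0 v 1) y
  && same_sem m y (nth 0 v 2))).
  by cpt_tac.
by cpt_tac.
Qed.
#[local] Hint Resolve cpt_matched : cpt.

Lemma cpt_equal_upto :
  cpt 3 (fun v => equal_upto (nth 0 v 0 + nth 0 v 1) (nth 0 v 0) (nth 0 v 1) (nth 0 v 2)).
Proof.
apply: (@cpt_all 3 _ (fun x v => (accept (nth 0 v 0) x ==> matched (nth 0 v 1) (nth 0 v 2) x) &&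
  (accept (nth 0 v 1) x && accept (nth 0 v 2) x ==> matched (nth 0 v 0) (nth 0 v 0) x))).
  by cpt_tac.
by cpt_tac.
Qed.

Lemma cpt_decide : cpt 2 (fun v => decide (nth 0 v 0) (nth 0 v 1)).
Proof.
apply: (@cpt_has 2 _ (fun e v => equal_upto (nth 0 v 0 + nth 0 v 1) (nth 0 v 0) (nth 0 v 1) e)).
  by cpt_tac.
apply: (cpt_comp3 (f := fun a b e => nat_of_bool (equal_upto (a + b) a b e)) cpt_equal_upto); by cpt_tac.
Qed.

Lemma sem_size w w' : sem m w = sem m w' -> size w = size w'.
Proof. by rewrite !sem_track => -[h1 h2]; rewrite (size_track m true w) (size_track m true w') h1 h2. Qed.

Lemma enc_word_le s w : alph_word m k w -> size w <= s -> enc_list w <= code_bound s.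
Proof.
move=> hw hs; apply: enc_list_le => //.
by apply/allP => a ha; move/allP: hw => /(_ a ha) /ltnW.
Qed.

Lemma matchedP D1 D2 w :
  reflect (exists w', [/\ lang m k D1 w', lang m k D2 w' & sem m w' = sem m w])
    (matched (enc_dfa D1) (enc_dfa D2) (enc_list w)).
Proof.
apply: (iffP hasP) => [[y _]|[w' [h1 h2 h3]]].
  have [w' ->] := enc_list_surj y.
  by case/andP => /andP [/acceptP h1 /acceptP h2] /same_semP h3; exists w'.
exists (enc_list w').
  rewrite mem_iota add0n ltnS /=; apply: enc_word_le; first by case: h1.
  by rewrite (sem_size h3) size_enc_list.
by apply/andP; split; [apply/andP; split; apply/acceptP | apply/same_semP].
Qed.

Lemma decideP A B : finite_shiftlag m (lang m k A) -> finite_shiftlag m (lang m k B) ->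
  unambiguous m (lang m k B) ->
  reflect (in_Rel m k (lang m k B) (sem_lang m (lang m k A))) (decide (enc_dfa A) (enc_dfa B)).
Proof.
move=> hA hB hU; apply: (iffP hasP) => [[e _]|hin].
  have [D ->] := enc_dfa_surj e => /allP hD.
  have {}hD w : alph_word m k w -> size w <= check_bound (enc_dfa A + enc_dfa B) (enc_dfa D) ->
      (lang m k A w -> exists w', inter m k B D w' /\ sem m w' = sem m w) /\
      (inter m k B D w -> exists w', lang m k A w' /\ sem m w' = sem m w).
    move=> ha hs; have := hD (enc_list w); rewrite mem_iota add0n ltnS /= => /(_ (enc_word_le ha hs)).
    case/andP => /implyP h1 /implyP h2; split.
      by move=> /acceptP /h1 /matchedP [w' [h3 h4 h5]]; exists w'.
    move=> [/acceptP h3 /acceptP h4].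
    by move: h2; rewrite h3 h4 => /(_ isT) /matchedP [w' [h5 _ h6]]; exists w'.
  apply: (included_in_Rel hA hB (D := D)) => w hs hw.
    by apply: (hD w _ hs).1 => //; case: hw.
  by apply: (hD w _ hs).2 => //; case: hw => -[].
have [D [hD hinc]] := in_Rel_dfa hA hB hU hin.
exists (enc_dfa D); first by rewrite mem_iota add0n ltnS.
(* The inclusions hold for words of every length, so the range of [x] does not matter in this
   direction. *)
apply/allP => x _; have [w ->] := enc_list_surj x; have [h1 h2] := hinc (size w).
apply/andP; split; apply/implyP.
  by move=> /acceptP /(h1 w (leqnn _)) [w' [[h3 h4] h5]]; apply/matchedP; exists w'.
case/andP => /acceptP h3 /acceptP h4.
by have [|w' [h5 h6]] := h2 w (leqnn _); [split | apply/matchedP; exists w'].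
Qed.

End Decision.

Theorem mainTheorem18 (m k : nat) :
  exists c : code, forall A B : dfa,
    finite_shiftlag m (lang m k A) ->
    finite_shiftlag m (lang m k B) ->
    unambiguous m (lang m k B) ->
    (in_Rel m k (lang m k B) (sem_lang m (lang m k A)) ->
       eval c [:: enc_dfa A; enc_dfa B] 1) /\
    (~ in_Rel m k (lang m k B) (sem_lang m (lang m k A)) ->
       eval c [:: enc_dfa A; enc_dfa B] 0).
Proof.
have [c hc] := cpt_decide m k; exists c => A B hA hB hU.
have := hc [:: enc_dfa A; enc_dfa B] erefl; rewrite /=.
by case: (decideP hA hB hU) => h he; split.
Qed.
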